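(* The decision problem 3-DIOMEGA-ORDERING — given a tournament $T$, decide whether $\vec{\omega}(T) \leq 3$ — is NP-complete.
   Context: A tournament is an orientation of a complete graph. Given a tournament $T$ and a total order $\prec$ on $V(T)$, the backedge graph $T^{\prec}$ is the undirected graph with vertex set $V(T)$ in which $u,v$ with $u \prec v$ are adjacent if and only if $vu \in A(T)$. The clique number of the tournament is $\vec{\omega}(T) = \min_{\prec} \omega(T^{\prec})$ over all total orders $\prec$ of $V(T)$. *)

(* Defs.v *)
From HB Require Import structures.
From mathcomp Require Import all_boot all_order all_algebra.

Set Implicit Arguments.
Unset Strict Implicit.
Unset Printing Implicit Defensive.

Definition is_tournament (V : finType) (A : rel V) : Prop :=
  irreflexive A /\ forall u v, u != v -> A u v (+) A v u.

(* A relation on [V] is represented by its graph, a set of pairs, so that the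
   minimum in [diomega] ranges over a finite type. *)
Definition strict_total_order (V : finType) (r : {set V * V}) : bool :=
  [&& [forall u, (u, u) \notin r],
      [forall u, forall v, forall w,
         ((u, v) \in r) && ((v, w) \in r) ==> ((u, w) \in r)]
    & [forall u, forall v, (u != v) ==> ((u, v) \in r) || ((v, u) \in r)]].

Definition backedge (V : finType) (A : rel V) (r : {set V * V}) : rel V :=
  fun u v => ((u, v) \in r) && A v u || ((v, u) \in r) && A u v.

Definition is_clique (V : finType) (E : rel V) (S : {set V}) : bool :=
  [forall u in S, forall v in S, (u != v) ==> E u v].

Definition clique_number (V : finType) (E : rel V) : nat :=
  \max_(S : {set V} | is_clique E S) #|S|.

(* The default value #|V| bounds every clique number, and a total order always
   exists, so this is the minimum over all total orders. *)
Definition diomega (V : finType) (A : rel V) : nat :=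
  \big[minn/#|V|]_(r : {set V * V} | strict_total_order r)
    clique_number (backedge A r).

(* Row-major adjacency matrix; its length n ^ 2 determines n. *)
Definition encode_tournament (n : nat) (A : rel 'I_n) : seq bool :=
  [seq A u v | u <- enum 'I_n, v <- enum 'I_n].

Definition language := seq bool -> Prop.

Definition three_diomega_ordering : language := fun w =>
  exists (n : nat) (A : rel 'I_n),
    [/\ is_tournament A, w = encode_tournament A & diomega A <= 3].

Inductive move := MoveL | Stay | MoveR.

Definition move_to_opt (m : move) : option bool :=
  match m with MoveL => Some false | Stay => None | MoveR => Some true end.
Definition move_of_opt (o : option bool) : move :=
  match o with Some false => MoveL | None => Stay | Some true => MoveR end.
Lemma move_to_optK : cancel move_to_opt move_of_opt. Proof. by case. Qed.
HB.instance Definition _ := Finite.copy move (can_type move_to_optK).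

(* [None] is the blank, [Some (inl b)] an input symbol, [Some (inr a)] an
   auxiliary work symbol. *)
Definition tsymbol (G : finType) := option (bool + G).

(* Multitape nondeterministic Turing machines with [tm_k.+1] tapes. In state
   [q] scanning the symbols [s], the machine may enter [q'], write [(a i).1] on
   tape [i] and move its head by [(a i).2] whenever [tm_delta q s q' a]. *)
Record tm := TM {
  tm_k : nat;
  tm_state : finType;
  tm_work : finType;
  tm_start : tm_state;
  tm_accept : pred tm_state;
  tm_delta : tm_state -> {ffun 'I_tm_k.+1 -> tsymbol tm_work} ->
             tm_state -> {ffun 'I_tm_k.+1 -> tsymbol tm_work * move} -> bool
}.

(* A tape infinite in both directions: [tleft], nearest cell first, [thead] the
   scanned cell, [tright]; all cells beyond the lists are blank. *)
Record tape (G : finType) := Tape {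
  tleft : seq (tsymbol G);
  thead : tsymbol G;
  tright : seq (tsymbol G)
}.

Definition tape_act (G : finType) (t : tape G) (a : tsymbol G * move) : tape G :=
  let: Tape l _ r := t in
  match a.2 with
  | MoveL => Tape (behead l) (head None l) (a.1 :: r)
  | Stay => Tape l a.1 r
  | MoveR => Tape (a.1 :: l) (head None r) (behead r)
  end.

Definition word_symbols (G : finType) (w : seq bool) : seq (tsymbol G) :=
  [seq Some (inl b) | b <- w].

Definition input_tape (G : finType) (w : seq bool) : tape G :=
  let s := word_symbols G w in Tape [::] (head None s) (behead s).

(* The tape contains the word [w] and is blank elsewhere. *)
Definition tape_contains (G : finType) (t : tape G) (w : seq bool) : Prop :=
  exists i j, rev (tleft t) ++ thead t :: tright t =
              nseq i None ++ word_symbols G w ++ nseq j None.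

Record config (M : tm) := Config {
  cstate : tm_state M;
  ctapes : {ffun 'I_(tm_k M).+1 -> tape (tm_work M)}
}.

Definition scanned (M : tm) (c : config M) :
    {ffun 'I_(tm_k M).+1 -> tsymbol (tm_work M)} :=
  [ffun i => thead (ctapes c i)].

Definition init_config (M : tm) (w : seq bool) : config M :=
  Config (tm_start M)
    [ffun i => input_tape (tm_work M) (if i == ord0 then w else [::])].

Definition step (M : tm) (c c' : config M) : Prop :=
  exists2 a, tm_delta (cstate c) (scanned c) (cstate c') a
           & ctapes c' = [ffun i => tape_act (ctapes c i) (a i)].

Fixpoint nsteps (M : tm) (n : nat) (c c' : config M) : Prop :=
  if n is n'.+1 then exists2 d, step c d & nsteps n' d c' else c = c'.

Definition halted (M : tm) (c : config M) : Prop := forall c', ~ step c c'.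

Definition deterministic (M : tm) : Prop :=
  forall q s q1 a1 q2 a2,
    @tm_delta M q s q1 a1 -> @tm_delta M q s q2 a2 -> q1 = q2 /\ a1 = a2.

Definition runs_in_time (M : tm) (p : {poly nat}) : Prop :=
  forall w n (c : config M),
    nsteps n (init_config M w) c -> n <= p.[size w]%R.

Definition polytime (M : tm) : Prop := exists p : {poly nat}, runs_in_time M p.

Definition accepts (M : tm) (w : seq bool) : Prop :=
  exists n (c : config M),
    [/\ nsteps n (init_config M w) c, halted c & tm_accept (cstate c)].

Definition in_NP (L : language) : Prop :=
  exists M : tm, polytime M /\ forall w, L w <-> accepts M w.

(* The input is on the first tape, the output on the last one. *)
Definition computes (M : tm) (f : seq bool -> seq bool) : Prop :=
  forall w, exists n (c : config M),
    [/\ nsteps n (init_config M w) c, halted c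
      & tape_contains (ctapes c ord_max) (f w)].

Definition polytime_computable (f : seq bool -> seq bool) : Prop :=
  exists M : tm, [/\ deterministic M, polytime M & computes M f].

Definition polytime_reducible (L1 L2 : language) : Prop :=
  exists f, polytime_computable f /\ forall w, L1 w <-> L2 (f w).

Definition NP_hard (L : language) : Prop :=
  forall L', in_NP L' -> polytime_reducible L' L.

Definition NP_complete (L : language) : Prop := in_NP L /\ NP_hard L.

(* Main.v *)
From HB Require Import structures.
From mathcomp Require Import all_boot all_order all_algebra zify.
From Stdlib Require Import FunctionalExtensionality.
Require Import Defs.

Set Implicit Arguments.
Unset Strict Implicit.
Unset Printing Implicit Defensive.

(** Hardness. Let [R] be a 7-vertex tournament with an order whose backedge graph is
    triangle-free, but which is not the union of two transitive tournaments, and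
    let [R1], [R2] be copies of it. In an order with no [K4] of the tournament
    [V => R2 => R1 => V], call a vertex of [V] low if some backedge of [R1] lies
    after it. Two low vertices are not joined by a backedge. If [x] is not low,
    then some backedge of [R1] lies before [x], hence some backedge of [R2] lies
    before [x] too (a backedge of [R2] after [x] would complete a [K4]), and so
    two non-low vertices are not joined by a backedge either. Thus [V] is the union
    of two transitive tournaments; conversely, if it is, putting one part before
    [R2], [R1] and the other one after gives clique number 3. Partition into two
    transitive tournaments encodes not-all-equal satisfiability: a 3-cycle is an
    arbitrary not-all-equal constraint, and a backedge passing over a 3-cycle
    forces distinct colours on its ends. Cook-Levin tableaux are encoded by clauses
    that only force the facts true in an actual run.

    Turing machines. Adjacency in the constructed tournament is an arithmetic
    expression in the two vertex numbers, built from addition, truncated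
    subtraction, bounded sums and bits of the input; such expressions compile to
    programs on unary counters, that is, tapes marked at their origin. The same
    compiler checks a guessed order, which gives membership in NP. *)

(** * Programs on counter tapes *)

Notation sym := (tsymbol unit).
Definition mark : sym := Some (inr tt).

Definition shift (m : move) (p : nat) : nat :=
  match m with MoveL => p.-1 | Stay => p | MoveR => p.+1 end.

Definition can_shift (m : move) (p : nat) : bool :=
  if m is MoveL then 0 < p else true.

(* The head of [t] is on cell [p] of a one-sided infinite tape with contents [c]. *)
Definition represents (G : finType) (t : tape G) (c : nat -> tsymbol G) (p : nat) :=
  [/\ tleft t = rev (mkseq c p), thead t = c p
    & forall j, nth None (tright t) j = c (p + j.+1)].

Lemma represents_act (G : finType) (t : tape G) c c' p a m :
  represents t c p -> can_shift m p -> c' p = a -> (forall j, j != p -> c' j = c j) ->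
  represents (tape_act t (a, m)) c' (shift m p).
Proof.
case: t => l h r [/= lE _ rE] + <- c'E.
have {}lE : l = rev (mkseq c' p).
  rewrite lE; congr rev; apply/eq_in_map => i; rewrite mem_iota => /andP[_ lt_ip].
  by rewrite c'E //; lia.
have {}rE j : nth None r j = c' (p + j.+1) by rewrite rE c'E //; lia.
case: m => /= [p_gt0||_].
- case: p p_gt0 lE rE {c'E} => // p _; rewrite mkseqS rev_rcons => -> rE.
  by split=> // -[|j] /=; [congr c'; lia | rewrite rE; congr c'; lia].
- by [].
- split; first by rewrite mkseqS rev_rcons lE.
    by rewrite -nth0 rE; congr c'; lia.
  by move=> j /=; rewrite nth_behead rE; congr c'; lia.
Qed.

Lemma represents_move (G : finType) (t : tape G) c p m :
  represents t c p -> can_shift m p ->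
  represents (tape_act t (thead t, m)) c (shift m p).
Proof. by move=> tc pm; apply: (represents_act tc) => //; case: tc. Qed.

Inductive prog :=
| Inc of nat
| Dec of nat
| Out of bool
| Seq of prog & prog
| While of nat & prog
| IfEq of nat & sym & prog & prog.

Inductive act := AStay | AMove of nat & move | AOut of bool.

Fixpoint prog_state (p : prog) : finType :=
  match p with
  | Seq p q => (prog_state p + prog_state q)%type
  | While _ p => option (prog_state p)
  | IfEq _ _ p q => option (prog_state p + prog_state q)
  | _ => unit
  end.

Fixpoint prog_entry (p : prog) : prog_state p :=
  match p with
  | Seq p q => inl (prog_entry p)
  | While _ p => None
  | IfEq _ _ p q => None
  | Inc _ => tt | Dec _ => tt | Out _ => tt
  end.

Definition relabel (X Y : Type) (inj : X -> Y) (exit : option Y)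
    (t : option X * act) : option Y * act :=
  (if t.1 is Some x then Some (inj x) else exit, t.2).

(* Next state, [None] being the exit, and action, as a function of the state
   and of the scanned symbols. *)
Fixpoint prog_trans (p : prog) :
    prog_state p -> (nat -> sym) -> option (prog_state p) * act :=
  match p return prog_state p -> (nat -> sym) -> option (prog_state p) * act with
  | Inc i => fun _ _ => (None, AMove i MoveR)
  | Dec i => fun _ s => (None, if s i == mark then AStay else AMove i MoveL)
  | Out b => fun _ _ => (None, AOut b)
  | Seq p q => fun x s =>
      match x with
      | inl x => relabel inl (Some (inr (prog_entry q))) (prog_trans x s)
      | inr y => relabel inr None (prog_trans y s)
      end
  | While i p => fun x s =>
      match x with
      | None => (if s i == mark then None else Some (Some (prog_entry p)), AStay)
      | Some x => relabel Some (Some None) (prog_trans x s)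
      end
  | IfEq i v p q => fun x s =>
      match x with
      | None => (Some (Some (if s i == v then inl (prog_entry p)
                             else inr (prog_entry q))), AStay)
      | Some (inl x) => relabel (Some \o inl) None (prog_trans x s)
      | Some (inr y) => relabel (Some \o inr) None (prog_trans y s)
      end
  end.

Fixpoint prog_width (p : prog) : nat :=
  match p with
  | Inc i => i.+1
  | Dec i => i.+1
  | Out _ => 0
  | Seq p q => maxn (prog_width p) (prog_width q)
  | While i p => maxn i.+1 (prog_width p)
  | IfEq i _ p q => maxn i.+1 (maxn (prog_width p) (prog_width q))
  end.

Definition act_below (k : nat) (a : act) : bool :=
  if a is AMove i _ then i < k else true.

Lemma act_below_leq k k' a : k <= k' -> act_below k a -> act_below k' a.
Proof. by case: a => //= i _ le_kk' lt_ik; apply: leq_trans le_kk'. Qed.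

Lemma prog_trans_below p x s : act_below (prog_width p) (@prog_trans p x s).2.
Proof.
elim: p x => [i|i|b|p IHp q IHq|i p IHp|i v p IHp q IHq] //= x.
- by case: ifP => //=.
- by case: x => x /=; [apply: act_below_leq (IHp x) | apply: act_below_leq (IHq x)]; lia.
- by case: x => [x|] //=; apply: act_below_leq (IHp x); lia.
- by case: x => [[x|x]|] //=; [apply: act_below_leq (IHp x) | apply: act_below_leq (IHq x)];
    lia.
Qed.

Lemma prog_trans_eq p x s s' : (forall i, i < prog_width p -> s i = s' i) ->
  @prog_trans p x s = prog_trans x s'.
Proof.
elim: p x => [i|i|b|p IHp q IHq|i p IHp|i v p IHp q IHq] //= x eq_s.
- by rewrite eq_s.
- by case: x => x; rewrite ?IHp ?IHq // => j lt_j; apply: eq_s; lia.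
- by case: x => [x|]; [rewrite IHp // => j lt_j; apply: eq_s; lia | rewrite eq_s //; lia].
- case: x => [[x|x]|]; rewrite ?IHp ?IHq //; try by move=> j lt_j; apply: eq_s; lia.
  by rewrite eq_s //; lia.
Qed.

(* Head positions of the tapes, and the output written so far. *)
Notation store := ((nat -> nat) * seq bool)%type.

Definition upd (s : nat -> nat) (i v : nat) : nat -> nat :=
  fun j => if j == i then v else s j.

Lemma upd_same s i v : upd s i v i = v.
Proof. by rewrite /upd eqxx. Qed.

Definition act_store (a : act) (st : store) : store :=
  match a with
  | AStay => st
  | AMove i m => (upd st.1 i (shift m (st.1 i)), st.2)
  | AOut b => (st.1, rcons st.2 b)
  end.

Definition act_enabled (a : act) (st : store) : bool :=
  if a is AMove i m then can_shift m (st.1 i) else true.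

Section Exec.
(* [C i] is the fixed contents of tape [i] on its nonnegative cells. *)
Variable C : nat -> nat -> sym.

Definition scan (st : store) : nat -> sym := fun i => C i (st.1 i).

Inductive exec_from (p : prog) : nat -> prog_state p -> store -> store -> Prop :=
| ExecExit x st a : prog_trans x (scan st) = (None, a) -> act_enabled a st ->
    exec_from 1 x st (act_store a st)
| ExecStep n x y st st' a : prog_trans x (scan st) = (Some y, a) ->
    act_enabled a st -> exec_from n y (act_store a st) st' ->
    exec_from n.+1 x st st'.

Definition exec (p : prog) n st st' := exec_from n (prog_entry p) st st'.

Lemma exec_from_embed_exit p q (inj : prog_state p -> prog_state q) n x st st' :
  (forall z s, prog_trans (inj z) s = relabel inj None (prog_trans z s)) ->
  exec_from n x st st' -> exec_from n (inj x) st st'.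
Proof.
move=> injE; elim=> [{}x {}st a xE en|m {}x y {}st {}st' a xE en _ IH].
  by apply: ExecExit; rewrite ?injE ?xE.
by apply: ExecStep IH => //; rewrite injE xE.
Qed.

Lemma exec_from_embed_next p q (inj : prog_state p -> prog_state q) y n m x st st1 st2 :
  (forall z s, prog_trans (inj z) s = relabel inj (Some y) (prog_trans z s)) ->
  exec_from n x st st1 -> exec_from m y st1 st2 -> exec_from (n + m) (inj x) st st2.
Proof.
move=> injE; elim=> [{}x {}st a xE en|k {}x z {}st {}st1 a xE en _ IH] yE.
  by rewrite add1n; apply: ExecStep yE; rewrite ?injE ?xE.
by rewrite addSn; apply: ExecStep (IH yE) => //; rewrite injE xE.
Qed.

Lemma exec_inc i s o : exec (Inc i) 1 (s, o) (upd s i (s i).+1, o).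
Proof. exact: (@ExecExit (Inc i) tt (s, o) (AMove i MoveR)). Qed.

Lemma exec_dec i s o : C i (s i) != mark -> 0 < s i ->
  exec (Dec i) 1 (s, o) (upd s i (s i).-1, o).
Proof.
move=> unmarked pos; apply: (@ExecExit (Dec i) tt (s, o) (AMove i MoveL)) => //=.
by rewrite (negbTE unmarked).
Qed.

Lemma exec_dec_mark i s o : C i (s i) = mark -> exec (Dec i) 1 (s, o) (s, o).
Proof.
move=> marked; apply: (@ExecExit (Dec i) tt (s, o) AStay) => //=.
by rewrite /scan marked eqxx.
Qed.

Lemma exec_out b s o : exec (Out b) 1 (s, o) (s, rcons o b).
Proof. exact: (@ExecExit (Out b) tt (s, o) (AOut b)). Qed.

Lemma exec_seq p q n m st st1 st2 :
  exec p n st st1 -> exec q m st1 st2 -> exec (Seq p q) (n + m) st st2.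
Proof.
move=> pE qE; apply: (@exec_from_embed_next p (Seq p q) inl) pE _ => //.
exact: (@exec_from_embed_exit q (Seq p q) inr).
Qed.

Lemma exec_while_end i p s o :
  C i (s i) = mark -> exec (While i p) 1 (s, o) (s, o).
Proof.
move=> marked; apply: (@ExecExit (While i p) None (s, o) AStay) => //=.
by rewrite /scan marked eqxx.
Qed.

Lemma exec_while_step i p n m s o st1 st2 : C i (s i) != mark ->
  exec p n (s, o) st1 -> exec (While i p) m st1 st2 ->
  exec (While i p) (n + m).+1 (s, o) st2.
Proof.
move=> unmarked pE whileE.
apply: (@ExecStep (While i p) _ None (Some (prog_entry p)) _ _ AStay) => //=.
  by rewrite (negbTE unmarked).
exact: (@exec_from_embed_next p (While i p) Some) pE whileE.
Qed.

Lemma exec_ifeq i v p q n s o st :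
  (if C i (s i) == v then exec p n (s, o) st else exec q n (s, o) st) ->
  exec (IfEq i v p q) n.+1 (s, o) st.
Proof.
move=> branchE.
pose y : prog_state p + prog_state q :=
  if C i (s i) == v then inl (prog_entry p) else inr (prog_entry q).
apply: (@ExecStep (IfEq i v p q) n None (Some y) _ _ AStay) => //=.
rewrite /y; case: ifP branchE => _.
  exact: (@exec_from_embed_exit p (IfEq i v p q) (Some \o inl)).
exact: (@exec_from_embed_exit q (IfEq i v p q) (Some \o inr)).
Qed.

Lemma exec_eq p n st st1 st2 : exec p n st st1 -> st1 = st2 -> exec p n st st2.
Proof. by move=> ? <-. Qed.

End Exec.

(** * Nondeterministic machines that guess a word and run a program *)

Lemma nsteps_trans (M : tm) n m (c d e : config M) :
  nsteps n c d -> nsteps m d e -> nsteps (n + m) c e.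
Proof.
elim: n c => [|n IHn] c /=; first by move=> ->.
by case=> x cx xd de; exists x => //; apply: IHn.
Qed.

Definition deterministic_at (M : tm) (q : tm_state M) : Prop :=
  forall s q1 a1 q2 a2,
    @tm_delta M q s q1 a1 -> @tm_delta M q s q2 a2 -> q1 = q2 /\ a1 = a2.

Lemma step_unique (M : tm) (c d d' : config M) :
  deterministic_at (cstate c) -> step c d -> step c d' -> d = d'.
Proof.
case: c d d' => q t [q1 t1] [q2 t2] /= det [a1 /= q1E t1E] [a2 /= q2E t2E].
by have [-> a12] := det _ _ _ _ _ q1E q2E; rewrite t1E t2E a12.
Qed.

Lemma nsteps_unique (M : tm) (D : pred (tm_state M)) n m (c d f : config M) :
  (forall q, D q -> deterministic_at q) ->
  (forall e e' : config M, D (cstate e) -> step e e' -> D (cstate e')) ->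
  D (cstate c) -> nsteps n c f -> halted f -> nsteps m c d ->
  m <= n /\ (halted d -> d = f).
Proof.
move=> det closed + + hf; elim: n c m => [|n IHn] c [|m] //= Dc.
- by move=> <- <-.
- by move=> cf [x cx _]; case: (hf x); rewrite -cf.
- by case=> x cx _ <-; split=> // hc; case: (hc x).
- case=> x cx xf [y cy yd]; have xy : x = y by apply: step_unique cx cy; apply: det.
  by subst y; apply: IHn xf yd; apply: closed cx.
Qed.

Inductive phase := Start | Guess | Verdict | Accept | Reject.

Definition phase_code (h : phase) : 'I_5 :=
  match h with
  | Start => @Ordinal 5 0 isT
  | Guess => @Ordinal 5 1 isT
  | Verdict => @Ordinal 5 2 isT
  | Accept => @Ordinal 5 3 isT
  | Reject => @Ordinal 5 4 isT
  end.
Definition phase_decode (i : 'I_5) : phase :=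
  nth Start [:: Start; Guess; Verdict; Accept; Reject] i.
Lemma phase_codeK : cancel phase_code phase_decode.
Proof. by case. Qed.
HB.instance Definition _ := Finite.copy phase (can_type phase_codeK).

Definition contents (w g : seq bool) (i : nat) : nat -> sym :=
  if i == 0 then nth None (word_symbols unit w)
  else if i == 1 then nth None (word_symbols unit g)
  else fun x => if x == 0 then mark else None.

Definition guess_store (n : nat) : store := (fun i => if i <= 2 then n else 0, [::]).

Section GuessMachine.
Variables (p : prog) (guessable : pred bool) (vtape : nat).

(* Tape [0] holds the input, tape [1] the guess, tapes [2] to [out_tape.-1] are
   counters with a mark in cell [0], and the output is written on [out_tape]. *)
Definition out_tape := maxn (prog_width p) vtape + 3.
Notation gm_state := (phase + prog_state p)%type.
Notation scanT := {ffun 'I_out_tape.+1 -> sym}.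
Notation actT := {ffun 'I_out_tape.+1 -> sym * move}.

Definition stay_act (s : scanT) : actT := [ffun j => (s j, Stay)].

Definition start_act (s : scanT) : actT :=
  [ffun j : 'I__ => (if 1 < j < out_tape then mark else s j, Stay)].

Definition guess_act (s : scanT) (b : bool) : actT :=
  [ffun j : 'I__ => if j == 1 :> nat then (Some (inl b), MoveR)
                    else (s j, if j <= 2 then MoveR else Stay)].

Definition prog_act (s : scanT) (a : act) : actT :=
  [ffun j : 'I__ => match a with
   | AStay => (s j, Stay)
   | AMove i m => (s j, if j == i :> nat then m else Stay)
   | AOut b => if j == out_tape :> nat then (Some (inl b), MoveR) else (s j, Stay)
   end].

Definition gm_delta (q : gm_state) (s : scanT) (q' : gm_state) (a : actT) : bool :=
  match q with
  | inl Start => (q' == inl Guess) && (a == start_act s)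
  | inl Guess =>
      if s ord0 == None
      then (q' == inr (prog_entry p)) && (a == stay_act s)
      else (q' == inl Guess) && [exists b, guessable b && (a == guess_act s b)]
  | inl Verdict =>
      (q' == inl (if s (inord vtape) == mark then Reject else Accept)) && (a == stay_act s)
  | inl _ => false
  | inr x =>
      let: (o, e) := prog_trans x (fun i => s (inord i)) in
      (q' == if o is Some y then inr y else inl Verdict) && (a == prog_act s e)
  end.

Definition guess_machine : tm :=
  @TM out_tape gm_state unit (inl Start) (pred1 (inl Accept)) gm_delta.

Lemma gm_deterministic_at q : q != inl Guess -> deterministic_at (M := guess_machine) q.
Proof.
case: q => [[]|x]; rewrite ?eqxx // => _ s q1 a1 q2 a2 //=.
- by move=> /andP[/eqP-> /eqP->] /andP[/eqP-> /eqP->].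
- by move=> /andP[/eqP-> /eqP->] /andP[/eqP-> /eqP->].
- by case: prog_trans => o e /andP[/eqP-> /eqP->] /andP[/eqP-> /eqP->].
Qed.

Lemma guess_machine_deterministic :
  (forall b b', guessable b -> guessable b' -> b = b') -> deterministic guess_machine.
Proof.
move=> uniq_guess q; case: (eqVneq q (inl Guess)) => [->|/gm_deterministic_at//].
move=> s q1 a1 q2 a2 /=.
case: ifP => _ /andP[/eqP-> a1E] /andP[/eqP-> a2E]; first by rewrite (eqP a1E) (eqP a2E).
have [b1 /andP[b1_ok /eqP->]] := existsP a1E; have [b2 /andP[b2_ok /eqP->]] := existsP a2E.
by rewrite (uniq_guess _ _ b1_ok b2_ok).
Qed.

Definition guessing_done (q : gm_state) : bool :=
  match q with inl Start | inl Guess => false | _ => true end.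

Lemma guessing_done_deterministic q :
  guessing_done q -> deterministic_at (M := guess_machine) q.
Proof. by move=> done; apply: gm_deterministic_at; apply: contraTneq done => ->. Qed.

Lemma guessing_done_step (c d : config guess_machine) :
  guessing_done (cstate c) -> step c d -> guessing_done (cstate d).
Proof.
move=> + [a /=]; case: (cstate c) => [[]|x] //= _.
- by case/andP=> /eqP-> _; case: ifP.
- by case: prog_trans => -[y|] e /andP[/eqP->].
Qed.

Definition store_represents (w g : seq bool) (c : config guess_machine) (st : store) : Prop :=
  forall j : 'I_out_tape.+1,
    if j == out_tape :> nat
    then represents (ctapes c j) (nth None (word_symbols unit st.2)) (size st.2)
    else represents (ctapes c j) (contents w g j) (st.1 j).

Definition next_config (c : config guess_machine) (q : gm_state) (a : actT) :
    config guess_machine :=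
  @Config guess_machine q [ffun j => tape_act (ctapes c j) (a j)].

Lemma next_configE (c d : config guess_machine) (q : gm_state) (a : actT) :
  cstate d = q -> ctapes d = [ffun j => tape_act (ctapes c j) (a j)] ->
  d = next_config c q a.
Proof. by case: d => q' t /= -> ->. Qed.

Lemma scannedE w g c st i : store_represents w g c st -> i < out_tape ->
  scanned c (inord i) = scan (contents w g) st i.
Proof.
move=> c_st lt_i; have := c_st (inord i); rewrite ffunE /scan.
by rewrite inordK ?ltn_eqF //; [case | lia].
Qed.

Lemma store_represents_stay w g c q st : store_represents w g c st ->
  store_represents w g (next_config c q (stay_act (scanned c))) st.
Proof.
move=> c_st j; have := c_st j; rewrite !ffunE.
by case: ifP => _ tE; apply: (represents_move (m := Stay) tE).
Qed.

Lemma represents_rcons (t : tape unit) (v : seq bool) b :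
  represents t (nth None (word_symbols unit v)) (size v) ->
  represents (tape_act t (Some (inl b), MoveR))
    (nth None (word_symbols unit (rcons v b))) (size v).+1.
Proof.
move=> tE; rewrite /word_symbols map_rcons.
apply: (represents_act (m := MoveR) tE) => // [|j]; rewrite nth_rcons size_map ?ltnn ?eqxx //.
by case: ltngtP => // lt_vj _; rewrite nth_default // size_map ltnW.
Qed.

Lemma store_represents_act w g c q st a : store_represents w g c st ->
  act_below out_tape a -> act_enabled a st ->
  store_represents w g (next_config c q (prog_act (scanned c) a)) (act_store a st).
Proof.
move=> c_st below en j; have := c_st j; rewrite !ffunE.
case: eqP => [jE|_].
  case: a below en => [|i m|b] /= below _ tE; try exact: (represents_move (m := Stay) tE).
    have /negbTE-> : nat_of_ord j != i by lia.
    exact: (represents_move (m := Stay) tE).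
  by rewrite size_rcons; apply: represents_rcons.
case: a below en => [|i m|b] /= below en tE; try exact: (represents_move (m := Stay) tE).
rewrite /upd; case: eqP => [ji|_]; last exact: (represents_move (m := Stay) tE).
by rewrite -ji in en *; apply: represents_move.
Qed.

Lemma exec_from_nsteps w g n x st st' c : exec_from (contents w g) n x st st' ->
  store_represents w g c st -> cstate c = inr x ->
  exists d, [/\ nsteps n c d, store_represents w g d st' & cstate d = inl Verdict].
Proof.
have transE y s (e : config guess_machine) : store_represents w g e s ->
    @prog_trans p y (fun i => scanned e (inord i)) = prog_trans y (scan (contents w g) s).
  by move=> e_s; apply: prog_trans_eq => i lt_i; apply: scannedE e_s _; rewrite /out_tape; lia.
have below y s : act_below out_tape (@prog_trans p y s).2.
  by apply: act_below_leq (prog_trans_below y s); rewrite /out_tape; lia.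
move=> run; elim: run c => {n x st st'} [x st a xE en|n x y st st' a xE en _ IH] c c_st cx.
  have := below x (scan (contents w g) st); rewrite xE /= => below_a.
  exists (next_config c (inl Verdict) (prog_act (scanned c) a)).
  split=> //; last exact: store_represents_act.
  eexists; last reflexivity; exists (prog_act (scanned c) a) => //=.
  by rewrite cx /= (transE _ st) // xE !eqxx.
have := below x (scan (contents w g) st); rewrite xE /= => below_a.
have [d [cd d_st dq]] := IH (next_config c (inr y) (prog_act (scanned c) a))
  (store_represents_act _ c_st below_a en) (erefl _).
exists d; split=> //; eexists; last exact: cd.
exists (prog_act (scanned c) a) => //=.
by rewrite cx /= (transE _ st) // xE !eqxx.
Qed.

Definition accepting_store w g (st : store) : bool :=
  contents w g vtape (st.1 vtape) != mark.

Definition verdict_state w g (st : store) : gm_state :=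
  inl (if accepting_store w g st then Accept else Reject).

Lemma verdict_state_accept w g st :
  tm_accept (t := guess_machine) (verdict_state w g st) = accepting_store w g st.
Proof. by rewrite /verdict_state; case: ifP. Qed.

Lemma halted_verdict (c : config guess_machine) w g st :
  cstate c = verdict_state w g st -> halted c.
Proof. by move=> cq d [a /=]; rewrite cq /verdict_state; case: ifP. Qed.

Lemma exec_verdict w g n st st' c : exec (contents w g) p n st st' ->
  store_represents w g c st -> cstate c = inr (prog_entry p) ->
  exists d, [/\ nsteps n.+1 c d, store_represents w g d st'
              & cstate d = verdict_state w g st'].
Proof.
move=> run c_st cq; have [d [cd d_st dq]] := exec_from_nsteps run c_st cq.
exists (next_config d (verdict_state w g st') (stay_act (scanned d))).
split=> //; last exact: store_represents_stay.
rewrite -addn1; apply: nsteps_trans cd _ => /=; eexists; last reflexivity.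
exists (stay_act (scanned d)) => //=; rewrite dq /=.
rewrite (scannedE d_st); last by rewrite /out_tape; lia.
by rewrite /verdict_state /accepting_store if_neg !eqxx.
Qed.

Lemma represents_input (v : seq bool) :
  represents (input_tape unit v) (nth None (word_symbols unit v)) 0.
Proof. by split=> //= j; rewrite ?nth_behead ?add0n // -nth0. Qed.

Lemma start_step w : exists2 c, step (init_config guess_machine w) c &
  store_represents w [::] c (guess_store 0) /\ cstate c = inl Guess.
Proof.
set c0 := init_config guess_machine w.
exists (next_config c0 (inl Guess) (start_act (scanned c0))).
  by exists (start_act (scanned c0)) => //=; rewrite !eqxx.
split=> // j; have w_tape := represents_input w; have nil_tape := represents_input [::].
have stay := represents_move (m := Stay).
rewrite !ffunE /= -[j == ord0]/(nat_of_ord j == 0) /contents if_same.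
case: (eqVneq (nat_of_ord j) out_tape) => [->|j_not_out].
  rewrite ltnn andbF ifF; last by rewrite /out_tape; lia.
  exact: stay nil_tape _.
case: (eqVneq (nat_of_ord j) 0) => [->|j_gt0] /=; first exact: stay w_tape _.
case: (eqVneq (nat_of_ord j) 1) => [->|j_gt1] /=; first exact: stay nil_tape _.
have -> : 1 < j < out_tape by have := ltn_ord j; lia.
apply: (represents_act (m := Stay) nil_tape) => // k k_gt0.
by rewrite (negbTE k_gt0) nth_nil.
Qed.

Lemma store_represents_guess w g b c :
  store_represents w g c (guess_store (size g)) ->
  store_represents w (rcons g b) (next_config c (inl Guess) (guess_act (scanned c) b))
    (guess_store (size g).+1).
Proof.
move=> c_st j; have := c_st j; rewrite !ffunE /=.
case: (eqVneq (nat_of_ord j) out_tape) => [->|_] tE.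
  rewrite !ifF; [exact: (represents_move (m := Stay) tE) | rewrite /out_tape; lia..].
case: (eqVneq (nat_of_ord j) 1) tE => [->|j_neq1] tE.
  by rewrite /= in tE *; apply: represents_rcons.
have -> : contents w (rcons g b) j = contents w g j by rewrite /contents (negbTE j_neq1).
by case: ifP tE => _ tE; [apply: (represents_move (m := MoveR) tE)
                         | apply: (represents_move (m := Stay) tE)].
Qed.

Lemma scanned_input_blank w g c : store_represents w g c (guess_store (size g)) ->
  size g <= size w -> (scanned c ord0 == None) = (size g == size w).
Proof.
move=> c_st le_gw; have -> : ord0 = inord 0 :> 'I_out_tape.+1.
  by apply: ord_inj; rewrite inordK.
rewrite (scannedE c_st); last by rewrite /out_tape; lia.
rewrite /scan /contents /=.
case: (ltngtP (size g) (size w)) le_gw => // [lt_gw|->] _.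
  by rewrite (nth_map false).
by rewrite nth_default ?size_map.
Qed.

Lemma guess_run w g1 g2 c : store_represents w g1 c (guess_store (size g1)) ->
  cstate c = inl Guess -> size (g1 ++ g2) = size w -> all guessable g2 ->
  exists d, [/\ nsteps (size g2) c d,
    store_represents w (g1 ++ g2) d (guess_store (size w)) & cstate d = inl Guess].
Proof.
elim: g2 g1 c => [|b g2 IH] g1 c c_st cq /=.
  by rewrite cats0 => sz _; exists c; split=> //; rewrite -sz.
rewrite size_cat /= => sz /andP[b_ok g2_ok].
have lt_gw : size g1 < size w by lia.
have := store_represents_guess b c_st; rewrite -(size_rcons g1 b) => c'_st.
have [//||//|d [cd d_st dq]] := IH _ _ c'_st; first by rewrite size_cat size_rcons; lia.
exists d; split=> //; last by rewrite -cat_rcons.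
eexists; last exact: cd.
exists (guess_act (scanned c) b) => //=.
rewrite cq /= (scanned_input_blank c_st (ltnW lt_gw)) ltn_eqF //=.
by apply/existsP; exists b; rewrite b_ok eqxx.
Qed.

Lemma exec_nsteps w g n st : size g = size w -> all guessable g ->
  exec (contents w g) p n (guess_store (size w)) st ->
  exists c, [/\ nsteps (size w + n + 3) (init_config guess_machine w) c,
    store_represents w g c st & cstate c = verdict_state w g st].
Proof.
move=> sz g_ok run; have [c0 start [c0_st c0q]] := start_step w.
have [//|//|c1 [c01 c1_st c1q]] := @guess_run w [::] g c0 c0_st c0q.
pose c2 := next_config c1 (inr (prog_entry p)) (stay_act (scanned c1)).
have [c3 [c23 c3_st c3q]] := exec_verdict run (store_represents_stay _ c1_st) (erefl _).
exists c3; split=> //.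
have -> : size w + n + 3 = 1 + (size g + (1 + n.+1)) by lia.
apply: (nsteps_trans (d := c0)); first by exists c0.
apply: nsteps_trans c01 _; apply: (nsteps_trans (d := c2)) => //.
exists c2 => //; exists (stay_act (scanned c1)) => //=.
by rewrite c1q /= -sz in c1_st *; rewrite (scanned_input_blank c1_st) ?sz // eqxx !eqxx.
Qed.

Lemma nsteps_guess w g1 c m d : store_represents w g1 c (guess_store (size g1)) ->
  all guessable g1 -> size g1 <= size w -> cstate c = inl Guess -> nsteps m c d ->
  (m <= size w - size g1 /\ cstate d = inl Guess) \/
  exists g c', [/\ size g = size w, all guessable g,
    store_represents w g c' (guess_store (size w)), cstate c' = inr (prog_entry p)
    & exists2 k, nsteps k c' d & m <= (size w - size g1).+1 + k].
Proof.
elim: m g1 c => [|m IH] g1 c c_st g1_ok le_gw cq /=; first by move=> <-; left.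
case=> e [a /= + eE] ed; rewrite cq /= (scanned_input_blank c_st le_gw).
case: eqP => [sz|neq_gw] /andP[/eqP eq_e].
  move=> /eqP aE; right; exists g1, e; split=> //; last by exists m => //; lia.
  by rewrite (next_configE eq_e eE) aE -sz; apply: store_represents_stay.
case/existsP=> b /andP[b_ok /eqP aE].
have := store_represents_guess b c_st.
rewrite -aE -(next_configE eq_e eE) -(size_rcons g1 b) => e_st.
have [||[le_m qd]|[g [c' [sz g_ok c'_st qc' [k c'd le_m]]]]] := IH _ _ e_st _ _ eq_e ed.
- by rewrite all_rcons b_ok.
- by rewrite size_rcons; lia.
- by left; split=> //; rewrite size_rcons in le_m; lia.
- right; exists g, c'; split=> //; exists k => //.
  by rewrite size_rcons in le_m; lia.
Qed.

Lemma nsteps_exec w m d : nsteps m (init_config guess_machine w) d ->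
  (m <= (size w).+1 /\ ~~ tm_accept (cstate d)) \/
  exists2 g, size g = size w /\ all guessable g &
    forall n st, exec (contents w g) p n (guess_store (size w)) st ->
    m <= size w + n + 3 /\ (halted d -> cstate d = verdict_state w g st).
Proof.
case: m => [|m] /=; first by move=> <-; left.
case=> e start ed; have [c0 start' [c0_st c0q]] := start_step w.
have ec0 : e = c0 by apply: step_unique start start'; apply: gm_deterministic_at.
rewrite {e start start'}ec0 in ed.
have [[le_m dq]|[g [c' [sz g_ok c'_st c'q [k c'd le_m]]]]] :=
  nsteps_guess c0_st isT (leq0n _) c0q ed.
  by left; rewrite dq subn0 in le_m *.
right; exists g => // n st run; have [f [c'f _ fq]] := exec_verdict run c'_st c'q.
have c'_done : guessing_done (cstate c') by rewrite c'q.
have [le_k df] := nsteps_unique (M := guess_machine) (D := guessing_done)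
  guessing_done_deterministic guessing_done_step c'_done c'f (halted_verdict fq) c'd.
by rewrite subn0 in le_m; split=> [|/df->//]; lia.
Qed.

Lemma store_represents_output w g c st : store_represents w g c st ->
  tape_contains (ctapes c ord_max) st.2.
Proof.
move=> /(_ ord_max); rewrite eqxx => -[leftE headE rightE].
exists 0, (size (tright (ctapes c ord_max))).+1 => /=.
rewrite leftE headE revK nth_default ?size_map //.
have -> : mkseq (nth None (word_symbols unit st.2)) (size st.2) = word_symbols unit st.2.
  by rewrite -[RHS](mkseq_nth None) size_map.
congr (_ ++ _ :: _).
apply: (@eq_from_nth _ None); rewrite ?size_nseq // => i lt_i.
by rewrite rightE nth_nseq lt_i nth_default // size_map; lia.
Qed.

End GuessMachine.

(** * Counter programs *)

Definition poly_bounded (f : nat -> nat) := exists c, forall n, f n <= (n + 2) ^ c.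

Lemma poly_bounded_const k : poly_bounded (fun=> k).
Proof.
exists k => n; case: k => // k.
by apply: leq_trans (ltnW (ltn_expl k.+1 (ltnSn 1))) _; rewrite leq_exp2r // leq_addl.
Qed.

Lemma poly_bounded_id : poly_bounded id.
Proof. by exists 1 => n; apply: leq_addr. Qed.

Lemma poly_bounded_add f h :
  poly_bounded f -> poly_bounded h -> poly_bounded (fun n => f n + h n).
Proof.
move=> [a f_le] [b h_le]; exists (maxn a b).+1 => n.
have fn : f n <= (n + 2) ^ maxn a b.
  by apply: leq_trans (f_le n) _; rewrite leq_exp2l ?leq_maxl //; lia.
have hn : h n <= (n + 2) ^ maxn a b.
  by apply: leq_trans (h_le n) _; rewrite leq_exp2l ?leq_maxr //; lia.
by rewrite expnS; nia.
Qed.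

Lemma poly_bounded_mul f h :
  poly_bounded f -> poly_bounded h -> poly_bounded (fun n => f n * h n).
Proof. by move=> [a f_le] [b h_le]; exists (a + b) => n; rewrite expnD leq_mul. Qed.

Lemma poly_bounded_comp f h :
  poly_bounded f -> poly_bounded h -> poly_bounded (fun n => f (h n)).
Proof.
move=> [a f_le] [b h_le]; exists (b.+2 * a) => n; apply: leq_trans (f_le _) _.
rewrite expnM; case: a {f_le} => // a; rewrite leq_exp2r // !expnS.
have pow_gt0 : 0 < (n + 2) ^ b by rewrite expn_gt0 addn2.
by have := h_le n; nia.
Qed.

Ltac poly_bound := repeat first
  [ assumption | exact: poly_bounded_id | exact: poly_bounded_const
  | apply: poly_bounded_add | apply: poly_bounded_mul
  | match goal with H : poly_bounded ?f |- poly_bounded (fun n => ?f _) =>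
      apply: (poly_bounded_comp H) end ].

Lemma poly_bounded_poly f : poly_bounded f ->
  exists p : {poly nat}, forall n, f n <= p.[n]%R.
Proof.
case=> c f_le; exists (('X + 2%:P) ^+ c)%R => n; apply: leq_trans (f_le n) _.
by rewrite horner_exp hornerD hornerX hornerC natrXE natrDE.
Qed.

Lemma exec_loop C i p (S : nat -> store) n B :
  (forall x, (C i x == mark) = (x == 0)) ->
  (forall k, k <= n -> (S k).1 i = n - k) ->
  (forall k, k < n -> exists2 t, t <= B & exec C p t (S k) (S k.+1)) ->
  exists2 t, t <= n * B.+1 + 1 & exec C (While i p) t (S 0) (S n).
Proof.
move=> markE counter body.
suff loop m k : k + m = n ->
    exists2 t, t <= m * B.+1 + 1 & exec C (While i p) t (S k) (S n) by exact: loop.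
elim: m k => [|m IH] k; rewrite ?addn0.
  move=> ->; exists 1 => //; have := counter n (leqnn n).
  case: (S n) => s o /= si0.
  by apply: exec_while_end; apply/eqP; rewrite markE si0 subnn.
move=> kmn; have lt_kn : k < n by lia.
have [t1 le_t1 run1] := body k lt_kn; have [|t2 le_t2 run2] := IH k.+1; first by lia.
exists (t1 + t2).+1; first by nia.
have := counter k (ltnW lt_kn); case: (S k) run1 => s o run1 /= si.
by apply: exec_while_step run1 run2; rewrite markE si; lia.
Qed.

Ltac upd_simp := rewrite /upd /=;
  repeat match goal with |- context [?a == ?b] => case: (@eqP _ a b) => ? end;
  subst; try lia.

Ltac upd_eq :=
  (lazymatch goal with |- (_, _) = _ => congr (_, _) | _ => idtac end);
  apply: functional_extensionality => j; upd_simp.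

Definition move_to i d := While i (Seq (Dec i) (Inc d)).

Definition move_to2 i d t := While i (Seq (Dec i) (Seq (Inc d) (Inc t))).

Definition copy i t d := Seq (move_to2 i d t) (move_to t i).

Definition clear i := While i (Dec i).

Definition sub_from i d := While i (Seq (Dec i) (Dec d)).

Definition sum_loop d body :=
  While d.+1 (Seq (Dec d.+1) (Seq body (Seq (move_to d.+3 d) (Inc d.+2)))).

Definition read_bit (b : bool) d :=
  Seq (move_to2 d.+1 d.+2 b)
 (Seq (IfEq b (Some (inl true)) (Inc d) (Dec d.+1))
      (sub_from d.+2 b)).

Definition prelude := While 2 (Seq (Dec 0) (Seq (Dec 1) (Seq (Dec 2) (Inc 3)))).

(* The head positions after [prelude]: counter [3] holds the length of the input. *)
Definition clean_pos (w : seq bool) : nat -> nat := fun i => if i == 3 then size w else 0.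

Section CounterPrograms.
Variables w g : seq bool.
Notation C := (contents w g).

Lemma contents_mark i x : 1 < i -> (C i x == mark) = (x == 0).
Proof. by case: i => [|[|i]] // _; rewrite /contents /=; case: (x == 0). Qed.

Lemma contents_unmarked i x : 0 < x -> C i x != mark.
Proof.
have word_unmarked v : nth None (word_symbols unit v) x != mark.
  by elim: v x => [|c v IH] [|x] //=; apply: IH.
by case: i => [|[|i]] x_gt0; rewrite /contents /= ?word_unmarked // gtn_eqF.
Qed.

Lemma contents_read (b : bool) x :
  (C b x == Some (inl true)) = nth false (if b then g else w) x.
Proof.
have wordE v : (nth None (word_symbols unit v) x == Some (inl true)) = nth false v x.
  by elim: v x => [|c v IH] [|x] //=; case: c.
by case: b; apply: wordE.
Qed.

Lemma exec_dec_pos i s o : 0 < s i -> exec C (Dec i) 1 (s, o) (upd s i (s i).-1, o).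
Proof. by move=> pos; apply: exec_dec => //; apply: contents_unmarked. Qed.

Lemma exec_move_to i d s o : 1 < i -> i <> d ->
  exists2 t, t <= s i * 3 + 1 &
    exec C (move_to i d) t (s, o) (upd (upd s i 0) d (s d + s i), o).
Proof.
move=> lt_1i neq_id.
have [|k _|k lt_k|t le_t run] := @exec_loop C i (Seq (Dec i) (Inc d))
  (fun k => (upd (upd s i (s i - k)) d (s d + k), o)) (s i) 2.
- by move=> x; apply: contents_mark.
- by upd_simp.
- exists 2 => //; apply: exec_eq (exec_seq (exec_dec_pos _ _) (exec_inc _ _ _ _)) _;
    by [upd_simp | upd_eq].
by exists t => //; rewrite subnn in run; move: run; congr exec; upd_eq.
Qed.

Lemma exec_move_to2 i d t s o : 1 < i -> i <> d -> i <> t -> d <> t ->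
  exists2 n, n <= s i * 4 + 1 & exec C (move_to2 i d t) n (s, o)
    (upd (upd (upd s i 0) d (s d + s i)) t (s t + s i), o).
Proof.
move=> lt_1i neq_id neq_it neq_dt.
have [|k _|k lt_k|n le_n run] := @exec_loop C i (Seq (Dec i) (Seq (Inc d) (Inc t)))
  (fun k => (upd (upd (upd s i (s i - k)) d (s d + k)) t (s t + k), o)) (s i) 3.
- by move=> x; apply: contents_mark.
- by upd_simp.
- exists 3 => //; apply: exec_eq (exec_seq (exec_dec_pos _ _)
    (exec_seq (exec_inc _ _ _ _) (exec_inc _ _ _ _))) _; by [upd_simp | upd_eq].
by exists n => //; rewrite subnn in run; move: run; congr exec; upd_eq.
Qed.

Lemma exec_copy i t d s o : 1 < i < d -> d < t -> s d = 0 -> s t = 0 ->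
  exists2 n, n <= s i * 7 + 2 & exec C (copy i t d) n (s, o) (upd s d (s i), o).
Proof.
move=> /andP[lt_1i lt_id] lt_dt sd0 st0.
have [||||n1 le_n1 run1] := @exec_move_to2 i d t s o; try lia.
set s1 := upd _ t _ in run1; have s1t : s1 t = s i by rewrite /s1; upd_simp.
have [||n2 le_n2 run2] := @exec_move_to t i s1 o; try lia.
exists (n1 + n2); first by rewrite s1t in le_n2; lia.
by apply: exec_eq (exec_seq run1 run2) _; rewrite s1t /s1; upd_eq.
Qed.

Lemma exec_clear i s o : 1 < i ->
  exists2 n, n <= s i * 2 + 1 & exec C (clear i) n (s, o) (upd s i 0, o).
Proof.
move=> lt_1i.
have [|k _|k lt_k|t le_t run] :=
  @exec_loop C i (Dec i) (fun k => (upd s i (s i - k), o)) (s i) 1.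
- by move=> x; apply: contents_mark.
- by upd_simp.
- exists 1 => //; apply: exec_eq (exec_dec_pos _ _) _; by [upd_simp | upd_eq].
by exists t => //; rewrite subnn in run; move: run; congr exec; upd_eq.
Qed.

(* An input tape has no mark at its origin, so it must not be decremented below [0]. *)
Lemma exec_sub_from i d s o : 1 < i -> i <> d -> (1 < d) || (s i <= s d) ->
  exists2 t, t <= s i * 3 + 1 &
    exec C (sub_from i d) t (s, o) (upd (upd s i 0) d (s d - s i), o).
Proof.
move=> lt_1i neq_id counter.
have [|k _|k lt_k|t le_t run] := @exec_loop C i (Seq (Dec i) (Dec d))
  (fun k => (upd (upd s i (s i - k)) d (s d - k), o)) (s i) 2.
- by move=> x; apply: contents_mark.
- by upd_simp.
- exists 2 => //; case: (posnP (s d - k)) => sdk.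
    apply: exec_eq (exec_seq (exec_dec_pos _ _) (exec_dec_mark _ _)) _.
    + by upd_simp.
    + by apply/eqP; rewrite contents_mark; [apply/eqP; upd_simp | lia].
    by upd_eq.
  by apply: exec_eq (exec_seq (exec_dec_pos _ _) (exec_dec_pos _ _)) _;
    [upd_simp | upd_simp | upd_eq].
by exists t => //; rewrite subnn in run; move: run; congr exec; upd_eq.
Qed.

Lemma exec_sum_loop d body (f : nat -> nat) c B s o :
  1 < d -> s d = 0 -> s d.+2 = 0 -> s d.+3 = 0 ->
  (forall k, k < s d.+1 -> f k <= c) ->
  (forall k, k < s d.+1 ->
     let s' := upd (upd (upd s d.+1 (s d.+1 - k.+1)) d.+2 k) d (\sum_(0 <= x < k) f x) in
     exists2 t, t <= B & exec C body t (s', o) (upd s' d.+3 (f k), o)) ->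
  exists2 t, t <= s d.+1 * (B + c * 3 + 3).+1 + 1 &
    exec C (sum_loop d body) t (s, o)
      (upd (upd (upd s d.+1 0) d.+2 (s d.+1)) d (\sum_(0 <= x < s d.+1) f x), o).
Proof.
move=> lt_1d sd0 sd2 sd3 f_le bodyE.
have [|k _|k lt_k|t le_t run] := @exec_loop C d.+1
  (Seq (Dec d.+1) (Seq body (Seq (move_to d.+3 d) (Inc d.+2))))
  (fun k => (upd (upd (upd s d.+1 (s d.+1 - k)) d.+2 k) d (\sum_(0 <= x < k) f x), o))
  (s d.+1) (B + c * 3 + 3).
- by move=> x; apply: contents_mark; lia.
- by upd_simp.
- rewrite big_nat_recr //=; have fk := f_le k lt_k.
  have [t1 le_t1 run1] := bodyE k lt_k.
  set F := \sum_(0 <= x < k) f x in run1 *; set s1 := upd _ d F in run1.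
  have [||t2 le_t2 run2] := @exec_move_to d.+3 d (upd s1 d.+3 (f k)) o; try lia.
  rewrite upd_same in le_t2.
  exists (1 + (t1 + (t2 + 1))); first by lia.
  have dec : exec C (Dec d.+1) 1 (upd (upd (upd s d.+1 (s d.+1 - k)) d.+2 k) d F, o) (s1, o).
    by apply: exec_eq (exec_dec_pos _ _) _; rewrite /s1; [upd_simp | upd_eq].
  apply: exec_eq (exec_seq dec (exec_seq run1 (exec_seq run2 (exec_inc _ _ _ _)))) _.
  by rewrite /s1; upd_eq.
exists t => //; rewrite subnn in run; move: run; congr exec.
by rewrite big_geq //; upd_eq.
Qed.

Lemma exec_read_bit (b : bool) d (s : nat -> nat) o : 1 < d -> s b = 0 -> s d = 0 -> s d.+2 = 0 ->
  exists2 t, t <= s d.+1 * 7 + 4 & exec C (read_bit b d) t (s, o)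
    (upd (upd s d.+1 0) d (nth false (if b then g else w) (s d.+1)), o).
Proof.
move=> lt_1d sb sd sd2; set n := s d.+1; set v := nth _ _ n.
have lt_b2 : b < 2 by case: b {sb v}.
have [||||t1 le_t1 run1] := @exec_move_to2 d.+1 d.+2 b s o; try lia.
rewrite sb sd2 !add0n -/n in run1; set s1 := upd _ b n in run1.
have run2 : exec C (IfEq b (Some (inl true)) (Inc d) (Dec d.+1)) 2 (s1, o) (upd s1 d v, o).
  apply: exec_ifeq; have -> : s1 b = n by rewrite /s1; upd_simp.
  have s1d : s1 d = 0 by rewrite /s1; upd_simp.
  rewrite contents_read -/v; case: (v); first by apply: exec_eq (exec_inc _ _ _ _) _; rewrite s1d.
  apply: exec_eq (exec_dec_mark _ _) _; last by upd_eq.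
  by apply/eqP; rewrite contents_mark; [apply/eqP; rewrite /s1; upd_simp | lia].
have s2b : upd s1 d v b = n by rewrite /s1; upd_simp.
have s2d2 : upd s1 d v d.+2 = n by rewrite /s1; upd_simp.
have [|||t3 le_t3 run3] := @exec_sub_from d.+2 b (upd s1 d v) o; rewrite ?s2b ?s2d2; try lia.
rewrite s2b s2d2 subnn in le_t3 run3.
exists (t1 + (2 + t3)); first by lia.
by apply: exec_eq (exec_seq run1 (exec_seq run2 run3)) _; rewrite /s1; upd_eq.
Qed.

Lemma exec_prelude : exists2 t, t <= size w * 5 + 1 &
  exec C prelude t (guess_store (size w)) (clean_pos w, [::]).
Proof.
have [|k _|k lt_k|t le_t run] := @exec_loop C 2
  (Seq (Dec 0) (Seq (Dec 1) (Seq (Dec 2) (Inc 3))))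
  (fun k => (fun i => if i <= 2 then size w - k else if i == 3 then k else 0, [::]))
  (size w) 4.
- by move=> x; apply: contents_mark.
- by [].
- exists 4 => //; apply: exec_eq (exec_seq (exec_dec_pos _ _) (exec_seq (exec_dec_pos _ _)
    (exec_seq (exec_dec_pos _ _) (exec_inc _ _ _ _)))) _ => /=; rewrite /upd /= ?subn_gt0 //.
  by congr (_, _); apply: functional_extensionality => -[|[|[|[|j]]]] //=; lia.
exists t => //; move: run; rewrite subnn subn0 /guess_store.
congr exec; congr (_, _); apply: functional_extensionality => i.
  by case: ifP => // _; case: ifP.
by rewrite /clean_pos; case: i => [|[|[|[|i]]]].
Qed.

End CounterPrograms.

(** * Compilation of arithmetic expressions *)

Definition scons (x : nat) (f : nat -> nat) : nat -> nat :=
  fun k => if k is k'.+1 then f k' else x.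

Inductive expr :=
| EVar of nat
| EOne
| ESize
| EAdd of expr & expr
| ESub of expr & expr
| ESum of expr & expr
| ERead of bool & expr.

(* Variables are de Bruijn indices; [ESum a b] binds one variable in [b]. *)
Fixpoint eval (w g : seq bool) (env : nat -> nat) (e : expr) : nat :=
  match e with
  | EVar k => env k
  | EOne => 1
  | ESize => size w
  | EAdd a b => eval w g env a + eval w g env b
  | ESub a b => eval w g env a - eval w g env b
  | ESum a b => \sum_(0 <= x < eval w g env a) eval w g (scons x env) b
  | ERead b a => nth false (if b then g else w) (eval w g env a)
  end.

(* [sg] maps variables to tapes; the value is left on tape [d], and the tapes
   above [d] are scratch. *)
Fixpoint compile (sg : nat -> nat) (d : nat) (e : expr) : prog :=
  match e with
  | EVar k => copy (sg k) d.+1 d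
  | EOne => Inc d
  | ESize => copy 3 d.+1 d
  | EAdd a b => Seq (compile sg d a) (Seq (compile sg d.+1 b) (move_to d.+1 d))
  | ESub a b => Seq (compile sg d a) (Seq (compile sg d.+1 b) (sub_from d.+1 d))
  | ESum a b => Seq (compile sg d.+1 a)
      (Seq (sum_loop d (compile (scons d.+2 sg) d.+3 b)) (clear d.+2))
  | ERead b a => Seq (compile sg d.+1 a) (read_bit b d)
  end.

Definition ready (w : seq bool) (sg : nat -> nat) (d : nat) (s : nat -> nat) :=
  [/\ forall i, 1 < sg i < d, 3 < d, forall i, d <= i -> s i = 0,
      s 0 = 0 /\ s 1 = 0 & s 3 = size w].

Lemma ready_leq w sg d d' s : d <= d' -> ready w sg d s -> ready w sg d' s.
Proof.
move=> le_dd' [sgE lt_3d high low s3]; split=> // [i||i le_d'i]; try lia.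
  by have := sgE i; lia.
by apply: high; lia.
Qed.

Lemma ready_upd w sg d s x : ready w sg d s -> ready w sg d.+1 (upd s d x).
Proof.
case=> sgE lt_3d high [s0 s1] s3; split; rewrite ?/upd ?ifF //; try lia.
- by move=> i; have := sgE i; lia.
- by move=> i lt_di; rewrite ifF; [apply: high; lia | lia].
Qed.

Lemma upd_env (sg : nat -> nat) d d' s x : (forall i, 1 < sg i < d) -> d <= d' ->
  (fun i => upd s d' x (sg i)) = (fun i => s (sg i)).
Proof.
move=> sgE le_dd'; apply: functional_extensionality => i; rewrite /upd ifF //.
by have := sgE i; lia.
Qed.

Lemma ready_clean_pos w d : 3 < d -> ready w (fun=> 2) d (clean_pos w).
Proof.
by move=> lt_3d; split=> // i; [lia | move=> le_di; rewrite /clean_pos ifF //; lia].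
Qed.

(* [T] and [V] bound the running time and the value in terms of a common bound on
   the input length and the variables. *)
Definition compile_spec (e : expr) (T V : nat -> nat) :=
  forall w g N s o sg d, ready w sg d s -> size w <= N -> (forall i, s (sg i) <= N) ->
  let v := eval w g (fun i => s (sg i)) e in
  v <= V N /\
  exists2 n, n <= T N & exec (contents w g) (compile sg d e) n (s, o) (upd s d v, o).

Definition compilable (e : expr) :=
  exists T V, [/\ poly_bounded T, poly_bounded V & compile_spec e T V].

Lemma compilable_var k : compilable (EVar k).
Proof.
exists (fun N => N * 7 + 2), id; split; [by poly_bound | by poly_bound |].
move=> w g N s o sg d [sgE _ high _ _] _ s_le /=; split=> //.
have [n le_n run] := exec_copy w g o (sgE k) (ltnSn d) (high d (leqnn d)) (high d.+1 (leqnSn d)).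
by exists n => //; apply: leq_trans le_n _; rewrite leq_add2r leq_mul2r s_le.
Qed.

Lemma compilable_one : compilable EOne.
Proof.
exists (fun=> 1), (fun=> 1); split; [by poly_bound | by poly_bound |].
move=> w g N s o sg d [_ _ high _ _] _ _ /=; split=> //.
by exists 1 => //; apply: exec_eq (exec_inc _ _ _ _) _; rewrite high.
Qed.

Lemma compilable_size : compilable ESize.
Proof.
exists (fun N => N * 7 + 2), id; split; [by poly_bound | by poly_bound |].
move=> w g N s o sg d [_ lt_3d high _ s3] le_wN _ /=; split=> //.
have [n le_n run] := exec_copy w g o (lt_3d : 1 < 3 < d) (ltnSn d) (high d (leqnn d))
  (high d.+1 (leqnSn d)).
by rewrite s3 in le_n run; exists n => //; lia.
Qed.

Lemma compile_binop a b (Ta Va Tb Vb : nat -> nat) P (op : nat -> nat -> nat) :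
  compile_spec a Ta Va -> compile_spec b Tb Vb ->
  (forall w g d s o, 1 < d -> exists2 t, t <= s d.+1 * 3 + 1 &
     exec (contents w g) (P d) t (s, o) (upd (upd s d.+1 0) d (op (s d) (s d.+1)), o)) ->
  forall w g N s o sg d, ready w sg d s -> size w <= N -> (forall i, s (sg i) <= N) ->
  let va := eval w g (fun i => s (sg i)) a in let vb := eval w g (fun i => s (sg i)) b in
  [/\ va <= Va N, vb <= Vb N &
    exists2 n, n <= Ta N + (Tb N + (Vb N * 3 + 1)) &
      exec (contents w g) (Seq (compile sg d a) (Seq (compile sg d.+1 b) (P d))) n (s, o)
        (upd s d (op va vb), o)].
Proof.
move=> aE bE PE w g N s o sg d rd le_w le_s va vb.
have [sgE lt_3d high _ _] := rd.
have [le_va [n1 le_n1 run1]] := aE w g N s o sg d rd le_w le_s.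
have [|le_vb [n2 le_n2 run2]] := bE w g N (upd s d va) o sg d.+1 (ready_upd _ rd) le_w.
  by move=> i; rewrite /upd ifF //; have := sgE i; lia.
rewrite (upd_env _ _ sgE (leqnn d)) -/vb in le_vb run2.
have [|t le_t run3] := PE w g d (upd (upd s d va) d.+1 vb) o; first by lia.
split=> //; exists (n1 + (n2 + t)); first by rewrite upd_same in le_t; lia.
apply: exec_eq (exec_seq run1 (exec_seq run2 run3)) _.
by have ? := high d.+1 (leqnSn d); upd_eq.
Qed.

Lemma compilable_add a b : compilable a -> compilable b -> compilable (EAdd a b).
Proof.
move=> [Ta [Va [pTa pVa aE]]] [Tb [Vb [pTb pVb bE]]].
exists (fun N => Ta N + (Tb N + (Vb N * 3 + 1))), (fun N => Va N + Vb N).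
split; [by poly_bound | by poly_bound |] => w g N s o sg d rd le_w le_s /=.
have [|le_va le_vb run] := @compile_binop a b Ta Va Tb Vb (fun d => move_to d.+1 d) addn
  aE bE _ w g N s o sg d rd le_w le_s.
  by move=> w' g' d' s' o' lt_1d; apply: exec_move_to; lia.
by split=> //; apply: leq_add.
Qed.

Lemma compilable_sub a b : compilable a -> compilable b -> compilable (ESub a b).
Proof.
move=> [Ta [Va [pTa pVa aE]]] [Tb [Vb [pTb pVb bE]]].
exists (fun N => Ta N + (Tb N + (Vb N * 3 + 1))), Va.
split; [by poly_bound | by poly_bound |] => w g N s o sg d rd le_w le_s /=.
have [|le_va le_vb run] := @compile_binop a b Ta Va Tb Vb (fun d => sub_from d.+1 d) subn
  aE bE _ w g N s o sg d rd le_w le_s.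
  by move=> w' g' d' s' o' lt_1d; apply: exec_sub_from; rewrite ?lt_1d //; lia.
by split=> //; apply: leq_trans (leq_subr _ _) le_va.
Qed.

Lemma compilable_read b a : compilable a -> compilable (ERead b a).
Proof.
move=> [Ta [Va [pTa pVa aE]]]; exists (fun N => Ta N + (Va N * 7 + 4)), (fun=> 1).
split; [by poly_bound | by poly_bound |] => w g N s o sg d rd le_w le_s /=.
split; first by case: nth.
have [_ lt_3d high [s0 s1] _] := rd.
have [le_va [n1 le_n1 run1]] := aE w g N s o sg d.+1 (ready_leq (leqnSn d) rd) le_w le_s.
set va := eval _ _ _ a in le_va run1 *.
have sb : s b = 0 by case: (b).
have [||||n2 le_n2 run2] := @exec_read_bit w g b d (upd s d.+1 va) o.
- by lia.
- by rewrite /upd ifF //; lia.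
- by rewrite /upd ifF ?high //; lia.
- by rewrite /upd ifF ?high //; lia.
rewrite upd_same in le_n2 run2; exists (n1 + n2); first by lia.
apply: exec_eq (exec_seq run1 run2) _.
by have ? := high d.+1 (leqnSn d); upd_eq.
Qed.

Lemma compile_sum_body b (Tb Vb : nat -> nat) w g N s o sg d k y z :
  compile_spec b Tb Vb -> 3 < d -> (forall i, sg i < d) -> ready w sg d.+2 s ->
  size w <= N -> (forall i, s (sg i) <= N) -> k <= N ->
  let s' := upd (upd (upd s d.+1 y) d.+2 k) d z in
  let v := eval w g (scons k (fun i => s (sg i))) b in
  v <= Vb N /\ exists2 t, t <= Tb N &
    exec (contents w g) (compile (scons d.+2 sg) d.+3 b) t (s', o) (upd s' d.+3 v, o).
Proof.
move=> bE lt_3d sg_lt [sgE _ high [s0 s1] s3] le_w le_s le_k s' v.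
have envE : (fun i => s' (scons d.+2 sg i)) = scons k (fun i => s (sg i)).
  apply: functional_extensionality => -[|i] /=; rewrite /s'; first by upd_simp.
  by have := sg_lt i; upd_simp.
have := bE w g N s' o (scons d.+2 sg) d.+3; rewrite envE; apply=> //.
  split=> [[|i]||i lt_di||] /=; rewrite /s' /upd ?ifF //; try by lia.
  - by have := sgE i; lia.
  - by apply: high; lia.
move=> i; have /= := congr1 (fun h => h i) envE => ->.
by case: i => [|i] /=; [lia | have := le_s i; lia].
Qed.

Lemma compilable_sum a b : compilable a -> compilable b -> compilable (ESum a b).
Proof.
move=> [Ta [Va [pTa pVa aE]]] [Tb [Vb [pTb pVb bE]]].
exists (fun N => Ta N + (Va N * (Tb (N + Va N) + Vb (N + Va N) * 3 + 3 + 1) + 1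
          + (Va N * 2 + 1))), (fun N => Va N * Vb (N + Va N)).
split; [by poly_bound | by poly_bound |] => w g N s o sg d rd le_w le_s /=.
have [sgE lt_3d high _ _] := rd; have rd1 := ready_leq (leqnSn d) rd.
have [le_n [t1 le_t1 run1]] := aE w g N s o sg d.+1 rd1 le_w le_s.
set n := eval w g _ a in le_n run1 *; set s1 := upd s d.+1 n in run1.
have envE : (fun i => s1 (sg i)) = (fun i => s (sg i)) := upd_env _ _ sgE (leqnSn d).
set f := fun x => eval w g (scons x (fun i => s (sg i))) b.
have body k z : k < n ->
    let s' := upd (upd (upd s1 d.+1 (n - k.+1)) d.+2 k) d z in
    f k <= Vb (N + Va N) /\ exists2 t, t <= Tb (N + Va N) &
      exec (contents w g) (compile (scons d.+2 sg) d.+3 b) t (s', o) (upd s' d.+3 (f k), o).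
  move=> lt_kn; rewrite /f -envE; apply: compile_sum_body => // [i|||i|]; try by lia.
  - by case/andP: (sgE i).
  - exact: ready_upd.
  - by have /= := congr1 (fun h => h i) envE => ->; apply: leq_trans (le_s i) (leq_addr _ _).
split.
  apply: leq_trans (_ : n * Vb (N + Va N) <= _); last by rewrite leq_mul2r le_n orbT.
  rewrite -[n in leqRHS]subn0 -sum_nat_const_nat !big_nat.
  by apply: leq_sum => k /andP[_ /(body k 0)[]].
have low_zero i : d <= i -> i != d.+1 -> s1 i = 0.
  by move=> le_di /negbTE neq_i; rewrite /s1 /upd neq_i high.
have [||||k|k|t2 le_t2 run2] := @exec_sum_loop w g d (compile (scons d.+2 sg) d.+3 b) f
  (Vb (N + Va N)) (Tb (N + Va N)) s1 o; rewrite ?{1}/s1 ?upd_same;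
  try by [lia | apply: low_zero; lia].
- by case/(body k 0).
- by case/(body k (\sum_(0 <= x < k) f x)).
rewrite /s1 upd_same -/s1 in le_t2 run2; set s2 := upd _ d _ in run2.
have [|t3 le_t3 run3] := @exec_clear w g d.+2 s2 o; first by lia.
have s2n : s2 d.+2 = n by rewrite /s2; upd_simp.
exists (t1 + (t2 + t3)); first by rewrite s2n in le_t3; nia.
apply: exec_eq (exec_seq run1 (exec_seq run2 run3)) _.
have ? := high d.+1 (leqnSn d); have ? := high d.+2 ltac:(lia).
by rewrite /s2 /s1; upd_eq.
Qed.

Lemma compileP e : compilable e.
Proof.
elim: e => [k|||a IHa b IHb|a IHa b IHb|a IHa b IHb|b a IHa].
- exact: compilable_var.
- exact: compilable_one.
- exact: compilable_size.
- exact: compilable_add.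
- exact: compilable_sub.
- exact: compilable_sum.
- exact: compilable_read.
Qed.

(** * Definable functions *)

(* Functions of the input, the guess and the values of the variables. *)
Notation context_fun V := (seq bool -> seq bool -> (nat -> nat) -> V).

Definition numeric (F : context_fun nat) :=
  exists e, forall w g env, eval w g env e = F w g env.
Definition definable (P : context_fun bool) := numeric (fun w g env => P w g env).

Definition up_ren (rho : nat -> nat) : nat -> nat :=
  fun k => if k is k'.+1 then (rho k').+1 else 0.

Fixpoint ren (rho : nat -> nat) (e : expr) : expr :=
  match e with
  | EVar k => EVar (rho k)
  | EOne => EOne
  | ESize => ESize
  | EAdd a b => EAdd (ren rho a) (ren rho b)
  | ESub a b => ESub (ren rho a) (ren rho b)
  | ESum a b => ESum (ren rho a) (ren (up_ren rho) b)
  | ERead b a => ERead b (ren rho a)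
  end.

Lemma eval_ren w g rho env e :
  eval w g env (ren rho e) = eval w g (fun k => env (rho k)) e.
Proof.
elim: e rho env => [k|||a IHa b IHb|a IHa b IHb|a IHa b IHb|b a IHa] rho env //=;
  rewrite ?IHa ?IHb //.
apply: eq_bigr => x _; rewrite IHb; congr eval.
by apply: functional_extensionality => -[|k].
Qed.

Section Closure.
Implicit Types (F G : context_fun nat) (P Q : context_fun bool).

Lemma eq_numeric F G : numeric F -> (forall w g e, F w g e = G w g e) -> numeric G.
Proof. by case=> x xF eqFG; exists x => w g env; rewrite xF eqFG. Qed.

Lemma numeric_ren F rho : numeric F -> numeric (fun w g e => F w g (fun k => e (rho k))).
Proof. by case=> x xF; exists (ren rho x) => w g env; rewrite eval_ren xF. Qed.

Lemma numeric_var k : numeric (fun _ _ e => e k).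
Proof. by exists (EVar k). Qed.

Lemma numeric_size : numeric (fun w _ _ => size w).
Proof. by exists ESize. Qed.

Lemma numeric_add F G : numeric F -> numeric G -> numeric (fun w g e => F w g e + G w g e).
Proof. by move=> [a aF] [b bG]; exists (EAdd a b) => w g env /=; rewrite aF bG. Qed.

Lemma numeric_sub F G : numeric F -> numeric G -> numeric (fun w g e => F w g e - G w g e).
Proof. by move=> [a aF] [b bG]; exists (ESub a b) => w g env /=; rewrite aF bG. Qed.

Lemma numeric_const c : numeric (fun _ _ _ => c).
Proof.
have one : numeric (fun _ _ _ => 1) by exists EOne.
elim: c => [|c IH]; first by exists (ESub EOne EOne).
by apply: eq_numeric (numeric_add IH one) _ => w g e; rewrite addn1.
Qed.

Lemma numeric_sum F (B : seq bool -> seq bool -> nat -> (nat -> nat) -> nat) :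
  numeric F -> numeric (fun w g e => B w g (e 0) (fun k => e k.+1)) ->
  numeric (fun w g e => \sum_(0 <= x < F w g e) B w g x e).
Proof.
move=> [a aF] [b bB]; exists (ESum a b) => w g env /=; rewrite aF.
by apply: eq_bigr => x _; rewrite bB.
Qed.

Lemma numeric_mul F G : numeric F -> numeric G -> numeric (fun w g e => F w g e * G w g e).
Proof.
move=> nF nG; apply: eq_numeric (numeric_sum (B := fun w g _ e => G w g e) nF _) _.
  exact: (numeric_ren succn nG).
by move=> w g e; rewrite sum_nat_const_nat subn0.
Qed.

Lemma numeric_succ F : numeric F -> numeric (fun w g e => (F w g e).+1).
Proof.
move=> nF; apply: eq_numeric (numeric_add nF (numeric_const 1)) _ => w g e.
exact: addn1.
Qed.

Lemma numeric_pred F : numeric F -> numeric (fun w g e => (F w g e).-1).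
Proof.
move=> nF; apply: eq_numeric (numeric_sub nF (numeric_const 1)) _ => w g e.
exact: subn1.
Qed.

Lemma definable_input F : numeric F -> definable (fun w g e => nth false w (F w g e)).
Proof. by case=> a aF; exists (ERead false a) => w g env /=; rewrite aF. Qed.

Lemma definable_guess F : numeric F -> definable (fun w g e => nth false g (F w g e)).
Proof. by case=> a aF; exists (ERead true a) => w g env /=; rewrite aF. Qed.

Lemma definable_const b : definable (fun _ _ _ => b).
Proof. exact: numeric_const. Qed.

Lemma definable_not P : definable P -> definable (fun w g e => ~~ P w g e).
Proof.
move=> dP; apply: eq_numeric (numeric_sub (numeric_const 1) dP) _ => w g e.
by case: (P w g e).
Qed.

Lemma definable_and P Q : definable P -> definable Q ->
  definable (fun w g e => P w g e && Q w g e).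
Proof. by move=> dP dQ; apply: eq_numeric (numeric_mul dP dQ) _ => w g e; rewrite mulnb. Qed.

Lemma definable_or P Q : definable P -> definable Q ->
  definable (fun w g e => P w g e || Q w g e).
Proof.
move=> dP dQ.
apply: eq_numeric (definable_not (definable_and (definable_not dP) (definable_not dQ))) _.
by move=> w g e; rewrite negb_and !negbK.
Qed.

Lemma definable_imp P Q : definable P -> definable Q ->
  definable (fun w g e => P w g e ==> Q w g e).
Proof.
move=> dP dQ; apply: eq_numeric (definable_or (definable_not dP) dQ) _ => w g e.
by rewrite implybE.
Qed.

Lemma definable_leq F G : numeric F -> numeric G -> definable (fun w g e => F w g e <= G w g e).
Proof.
move=> nF nG; apply: eq_numeric (numeric_sub (numeric_const 1) (numeric_sub nF nG)) _.
by move=> w g e; case: leqP; lia.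
Qed.

Lemma definable_eq F G : numeric F -> numeric G -> definable (fun w g e => F w g e == G w g e).
Proof.
move=> nF nG; apply: eq_numeric (definable_and (definable_leq nF nG) (definable_leq nG nF)) _.
by move=> w g e; rewrite eqn_leq.
Qed.

Lemma definable_eqb P Q : definable P -> definable Q ->
  definable (fun w g e => P w g e == Q w g e).
Proof.
move=> dP dQ; apply: eq_numeric (definable_eq dP dQ) _ => w g e.
by case: (P w g e); case: (Q w g e).
Qed.

Lemma definable_addb P Q : definable P -> definable Q ->
  definable (fun w g e => P w g e (+) Q w g e).
Proof.
move=> dP dQ; apply: eq_numeric (definable_not (definable_eqb dP dQ)) _ => w g e.
by case: (P w g e); case: (Q w g e).
Qed.

Lemma numeric_if P F G : definable P -> numeric F -> numeric G ->
  numeric (fun w g e => if P w g e then F w g e else G w g e).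
Proof.
move=> dP nF nG.
apply: eq_numeric (numeric_add (numeric_mul dP nF) (numeric_mul (definable_not dP) nG)) _.
by move=> w g e; case: (P w g e); rewrite /= mul1n mul0n ?addn0.
Qed.

Lemma definable_if P Q R : definable P -> definable Q -> definable R ->
  definable (fun w g e => if P w g e then Q w g e else R w g e).
Proof.
by move=> dP dQ dR; apply: eq_numeric (numeric_if dP dQ dR) _ => w g e; case: (P w g e).
Qed.

Lemma definable_all F (B : seq bool -> seq bool -> nat -> (nat -> nat) -> bool) :
  numeric F -> definable (fun w g e => B w g (e 0) (fun k => e k.+1)) ->
  definable (fun w g e => all (fun x => B w g x e) (iota 0 (F w g e))).
Proof.
move=> nF dB; apply: eq_numeric (numeric_sub (numeric_const 1)
  (numeric_sum (B := fun w g x e => ~~ B w g x e) nF (definable_not dB))) _ => w g e.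
rewrite /index_iota subn0 -big_mkcond sum1_count -(negbK (all _ _)) -has_predC has_count.
by rewrite /predC /=; case: count.
Qed.

Lemma definable_has F (B : seq bool -> seq bool -> nat -> (nat -> nat) -> bool) :
  numeric F -> definable (fun w g e => B w g (e 0) (fun k => e k.+1)) ->
  definable (fun w g e => has (fun x => B w g x e) (iota 0 (F w g e))).
Proof.
move=> nF dB; apply: eq_numeric (definable_not (definable_all
  (B := fun w g x e => ~~ B w g x e) nF (definable_not dB))) _ => w g e.
by rewrite -has_predC; congr nat_of_bool; apply: eq_has => x /=; rewrite negbK.
Qed.

Lemma divn_sum m d : 0 < d -> m %/ d = \sum_(0 <= x < m) (x.+1 * d <= m).
Proof.
move=> d_gt0; rewrite -[LHS]muln1 -[X in X * _]subn0 -sum_nat_const_nat.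
rewrite (big_nat_widen _ _ m) ?leq_div // big_mkcond.
by apply: eq_bigr => x _; rewrite /= leq_divRL //; case: ifP.
Qed.

Lemma numeric_div F G : numeric F -> numeric G -> numeric (fun w g e => F w g e %/ G w g e).
Proof.
move=> nF nG.
have nsum : numeric (fun w g e => \sum_(0 <= x < F w g e) (x.+1 * G w g e <= F w g e)).
  apply: (numeric_sum (B := fun w g x e => nat_of_bool (x.+1 * G w g e <= F w g e))) => //.
  apply: definable_leq; last exact: (numeric_ren succn nF).
  by apply: numeric_mul; [apply/numeric_succ/numeric_var | apply: (numeric_ren succn nG)].
apply: eq_numeric (numeric_if (definable_leq nG (numeric_const 0)) (numeric_const 0) nsum) _.
by move=> w g e; case: leqP => [|/divn_sum ->//]; rewrite leqn0 => /eqP->; rewrite divn0.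
Qed.

Lemma numeric_mod F G : numeric F -> numeric G -> numeric (fun w g e => F w g e %% G w g e).
Proof.
move=> nF nG; apply: eq_numeric (numeric_sub nF (numeric_mul (numeric_div nF nG) nG)) _.
by move=> w g e; rewrite {1}(divn_eq (F w g e) (G w g e)) addKn.
Qed.

Lemma numeric_horner (p : {poly nat}) F : numeric F -> numeric (fun w g e => p.[F w g e]%R).
Proof.
move=> nF; elim/poly_ind: p => [|p c IH].
  by apply: eq_numeric (numeric_const 0) _ => w g e; rewrite horner0.
apply: eq_numeric (numeric_add (numeric_mul IH nF) (numeric_const c)) _ => w g e.
by rewrite hornerMXaddC.
Qed.

Lemma numeric_cases c (F : nat -> context_fun nat) (K : context_fun nat) :
  (forall k, numeric (F k)) -> (forall k w g e, c <= k -> F k w g e = F c w g e) ->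
  numeric K -> numeric (fun w g e => F (K w g e) w g e).
Proof.
move=> nF F_const nK.
suff upto d : numeric (fun w g e => F (if K w g e < d then K w g e else c) w g e).
  by apply: eq_numeric (upto c) _ => w g e; case: ltnP => // le_cK; rewrite (F_const (K w g e)).
elim: d => [|d IH]; first exact: nF.
apply: eq_numeric (numeric_if (definable_eq nK (numeric_const d)) (nF d) IH) _ => w g e.
by rewrite ltnS; case: (ltngtP (K w g e) d) => // ->.
Qed.

Lemma definable_cases c (P : nat -> context_fun bool) (K : context_fun nat) :
  (forall k, definable (P k)) -> (forall k w g e, c <= k -> P k w g e = P c w g e) ->
  numeric K -> definable (fun w g e => P (K w g e) w g e).
Proof.
move=> dP P_const nK.
by apply: (@numeric_cases c (fun k w g e => P k w g e)) => // k w g e /P_const->.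
Qed.

End Closure.

Ltac numeric_step :=
  lazymatch goal with
  | |- definable (fun w g e => all (fun x => @?B w g x e) (iota 0 (@?F w g e))) =>
      apply: (@definable_all F B)
  | |- definable (fun w g e => has (fun x => @?B w g x e) (iota 0 (@?F w g e))) =>
      apply: (@definable_has F B)
  | |- definable (fun w g e => (@?P w g e) && (@?Q w g e)) => apply: (@definable_and P Q)
  | |- definable (fun w g e => (@?P w g e) || (@?Q w g e)) => apply: (@definable_or P Q)
  | |- definable (fun w g e => (@?P w g e) ==> (@?Q w g e)) => apply: (@definable_imp P Q)
  | |- definable (fun w g e => (@?P w g e) (+) (@?Q w g e)) => apply: (@definable_addb P Q)
  | |- definable (fun w g e => ~~ (@?P w g e)) => apply: (@definable_not P)
  | |- definable (fun w g e => nth false w (@?F w g e)) => apply: (@definable_input F)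
  | |- definable (fun w g e => nth false g (@?F w g e)) => apply: (@definable_guess F)
  | |- definable (fun w g e => leq (@?F w g e) (@?G w g e)) => apply: (@definable_leq F G)
  | |- definable (fun w g e => @eq_op bool (@?F w g e) (@?G w g e)) => apply: (@definable_eqb F G)
  | |- definable (fun w g e => @eq_op _ (@?F w g e) (@?G w g e)) =>
      first [apply: (@definable_eq F G) | apply: (@definable_eqb F G)]
  | |- numeric (fun w g e => size w) => exact: numeric_size
  | |- numeric (fun w g e => e ?k) => exact: (numeric_var k)
  | |- numeric (fun w g e => (@?F w g e) + (@?G w g e)) => apply: (@numeric_add F G)
  | |- numeric (fun w g e => (@?F w g e) * (@?G w g e)) => apply: (@numeric_mul F G)
  | |- numeric (fun w g e => (@?F w g e) - (@?G w g e)) => apply: (@numeric_sub F G)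
  | |- numeric (fun w g e => (@?F w g e) %/ (@?G w g e)) => apply: (@numeric_div F G)
  | |- numeric (fun w g e => (@?F w g e) %% (@?G w g e)) => apply: (@numeric_mod F G)
  | |- numeric (fun w g e => (@?F w g e).+1) => apply: (@numeric_succ F)
  | |- numeric (fun w g e => (@?F w g e).-1) => apply: (@numeric_pred F)
  | |- numeric (fun w g e => nat_of_bool (@?P w g e)) => change (definable P)
  | |- numeric _ => first [exact: numeric_const | apply: numeric_if]
  | |- definable _ => first [exact: definable_const | apply: definable_if]
  end; cbv beta.

Ltac numeric := repeat first [assumption | numeric_step].

(** * Nondeterministic verifiers and reductions to matrices *)

(* Closed expressions have no variables; counter [2] is [0] after [prelude]. *)
Notation closed_env := (fun=> 2).

Lemma exec_compiled e : exists2 T, poly_bounded T & forall w g, exists2 n, n <= T (size w) &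
  exec (contents w g) (Seq prelude (compile closed_env 4 e)) n (guess_store (size w))
    (upd (clean_pos w) 4 (eval w g (fun=> 0) e), [::]).
Proof.
have [T [V [pT pV eE]]] := compileP e.
exists (fun n => (n * 5 + 1) + T n); first by poly_bound.
move=> w g; have [n1 le_n1 run1] := exec_prelude w g.
have [//|_ [n2 le_n2 run2]] :=
  eE w g (size w) (clean_pos w) [::] closed_env 4 (ready_clean_pos w (ltnSn 3)) (leqnn _).
by exists (n1 + n2); [rewrite leq_add | apply: exec_seq run1 run2].
Qed.

Lemma polytime_guess_machine p guessable vtape (T : nat -> nat) : poly_bounded T ->
  (forall w g, size g = size w -> all guessable g -> exists n st, n <= T (size w) /\
     exec (contents w g) p n (guess_store (size w)) st) ->
  polytime (guess_machine p guessable vtape).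
Proof.
move=> pT run; have [|q q_ge] := @poly_bounded_poly (fun n => n + T n + 3); first by poly_bound.
exists q => w m c /nsteps_exec [[le_m _]|[g [sz g_ok] bound]]; apply: leq_trans (q_ge _).
  by lia.
have [n [st [le_n run_g]]] := run w g sz g_ok.
by have [le_m _] := bound _ _ run_g; lia.
Qed.

Theorem in_NP_definable (P : seq bool -> seq bool -> bool) :
  definable (fun w g _ => P w g) ->
  in_NP (fun w => exists2 g, size g = size w & P w g).
Proof.
case=> e eP; have [T pT run] := exec_compiled e.
set p := Seq prelude _ in run.
exists (guess_machine p predT 4); split.
  apply: polytime_guess_machine pT _ => w g _ _; have [n le_n run_g] := run w g.
  by exists n; eexists; split; last exact: run_g.
have acceptE w g : accepting_store 4 w g
    (upd (clean_pos w) 4 (eval w g (fun=> 0) e), [::]) = P w g.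
  by rewrite /accepting_store contents_mark //= upd_same eP eqb0 negbK.
move=> w; split=> [[g sz Pwg]|[m [c [wc hc acc]]]].
  have [n _ run_g] := run w g.
  have [|c [wc _ cq]] := exec_nsteps (guessable := predT) 4 sz _ run_g; first exact/allP.
  exists (size w + n + 3), c; split=> //; first exact: halted_verdict cq.
  by rewrite cq verdict_state_accept acceptE.
have [[_]|[g [sz _] bound]] := nsteps_exec wc; first by rewrite acc.
have [n _ run_g] := run w g; have [_ /(_ hc) cq] := bound _ _ run_g.
by exists g => //; rewrite -acceptE -(verdict_state_accept p predT) -cq.
Qed.

Definition matrix_word (n : nat) (a : nat -> nat -> bool) : seq bool :=
  [seq a u v | u <- iota 0 n, v <- iota 0 n].

Lemma matrix_rowsS (a : nat -> nat -> bool) k n :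
  [seq a u v | u <- iota 0 k.+1, v <- iota 0 n] =
  [seq a u v | u <- iota 0 k, v <- iota 0 n] ++ mkseq (a k) n.
Proof. by rewrite -addn1 iotaD map_cat flatten_cat /= cats0. Qed.

(* Counters [4] to [7]: remaining rows, current row, remaining columns, current column. *)
Section MatrixProgram.
Variables (dim entry : expr) (Td Vd Te Ve : nat -> nat).
Hypotheses (dimE : compile_spec dim Td Vd) (entryE : compile_spec entry Te Ve).

Notation entry_env := (scons 7 (scons 5 closed_env)).

Definition entry_prog := Seq (Dec 6) (Seq (compile entry_env 8 entry)
  (Seq (IfEq 8 mark (Out false) (Seq (clear 8) (Out true))) (Inc 7))).
Definition row_prog := Seq (Dec 4) (Seq (compile closed_env 6 dim)
  (Seq (While 6 entry_prog) (Seq (clear 7) (Inc 5)))).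
Definition matrix_prog :=
  Seq (Seq prelude (compile closed_env 4 dim)) (While 4 row_prog).

Definition entry_time N := Te (N + Vd N) + 8.
Definition row_time N := Td N + Vd N * (entry_time N + 1) + Vd N * 2 + 4.
Definition matrix_time N := N * 5 + 1 + Td N + (Vd N * (row_time N + 1) + 1).

Variables (w g : seq bool) (n : nat) (a : nat -> nat -> bool).
Hypothesis eval_dim : forall env, eval w g env dim = n.
Hypothesis eval_entry : forall u v, eval w g (scons v (scons u (fun=> 0))) entry = a u v.

Let N := size w.
Let pos x4 x5 x6 x7 := upd (upd (upd (upd (clean_pos w) 4 x4) 5 x5) 6 x6) 7 x7.

Lemma exec_dim d s o : ready w closed_env d s -> s 2 = 0 ->
  n <= Vd N /\
  exists2 t, t <= Td N & exec (contents w g) (compile closed_env d dim) t (s, o) (upd s d n, o).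
Proof.
move=> rd s2; have := dimE g o rd (leqnn N) (fun=> _).
by rewrite eval_dim s2; apply.
Qed.

Lemma dim_leq : n <= Vd N.
Proof. by case: (exec_dim [::] (ready_clean_pos w (ltnSn 3))). Qed.

Lemma exec_output_bit (b : bool) s o : s 8 = 0 ->
  exists2 t, t <= 6 & exec (contents w g)
    (IfEq 8 mark (Out false) (Seq (clear 8) (Out true))) t (upd s 8 b, o) (s, rcons o b).
Proof.
move=> s8; have s8E : upd s 8 0 = s by upd_eq.
case: b => /=; last first.
  by exists 2 => //; apply: exec_ifeq; rewrite contents_mark //= s8E; apply: exec_out.
have [//|t le_t run] := @exec_clear w g 8 (upd s 8 1) o.
exists (t + 1).+1; first by rewrite upd_same in le_t; lia.
apply: exec_ifeq; rewrite contents_mark //=; apply: exec_seq (exec_eq run _) (exec_out _ _ _ _).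
by upd_eq.
Qed.

Lemma exec_entry x4 u k o : u < n -> k < n ->
  exists2 t, t <= entry_time N & exec (contents w g) entry_prog t
    (pos x4 u (n - k) k, o) (pos x4 u (n - k.+1) k.+1, rcons o (a u k)).
Proof.
move=> lt_un lt_kn; have le_n := dim_leq.
have run1 : exec (contents w g) (Dec 6) 1 (pos x4 u (n - k) k, o) (pos x4 u (n - k.+1) k, o).
  by apply: exec_eq (exec_dec_pos _ _ _ _) _; rewrite /pos; [upd_simp | upd_eq].
set s := pos _ _ (n - k.+1) k in run1.
have envE : (fun i => s (entry_env i)) = scons k (scons u (fun=> 0)).
  by apply: functional_extensionality => -[|[|i]].
have rd : ready w entry_env 8 s.
  split=> //; first by case=> [|[|i]].
  by move=> i lt_i; rewrite /s /pos /upd /clean_pos !ifF //; lia.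
have [||_ [t2 le_t2 run2]] := entryE g (N := N + Vd N) o rd.
- exact: leq_addr.
- by move=> i; have /= := congr1 (fun f => f i) envE => ->; case: i => [|[|i]] /=; lia.
rewrite envE eval_entry in run2.
have [//|t3 le_t3 run3] := exec_output_bit (a u k) (s := s) o.
exists (1 + (t2 + (t3 + 1))); first by rewrite /entry_time; lia.
apply: exec_eq (exec_seq run1 (exec_seq run2 (exec_seq run3 (exec_inc _ _ _ _)))) _.
by rewrite /s /pos; upd_eq.
Qed.

Lemma exec_row k o : k < n ->
  exists2 t, t <= row_time N & exec (contents w g) row_prog t
    (pos (n - k) k 0 0, o) (pos (n - k.+1) k.+1 0 0, o ++ mkseq (a k) n).
Proof.
move=> lt_kn; have le_n := dim_leq.
have run1 : exec (contents w g) (Dec 4) 1 (pos (n - k) k 0 0, o) (pos (n - k.+1) k 0 0, o).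
  by apply: exec_eq (exec_dec_pos _ _ _ _) _; rewrite /pos; [upd_simp | upd_eq].
have rd : ready w closed_env 6 (pos (n - k.+1) k 0 0).
  by split=> // i lt_i; rewrite /pos /upd /clean_pos; do !case: eqP => //; lia.
have [//|_ [t2 le_t2 run2]] := exec_dim o rd.
have [||i lt_i|t3 le_t3 run3] := @exec_loop (contents w g) 6 entry_prog
  (fun i => (pos (n - k.+1) k (n - i) i, o ++ mkseq (a k) i)) n (entry_time N).
- by move=> x; apply: contents_mark.
- by [].
- have [t le_t run] := exec_entry (n - k.+1) (o ++ mkseq (a k) i) lt_kn lt_i.
  by exists t => //; rewrite mkseqS -rcons_cat.
rewrite subn0 subnn cats0 in run3.
have [//|t4 le_t4 run4] := @exec_clear w g 7 (pos (n - k.+1) k 0 n) (o ++ mkseq (a k) n).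
rewrite /pos upd_same in le_t4.
exists (1 + (t2 + (t3 + (t4 + 1)))).
  have le_loop : n * (entry_time N).+1 <= Vd N * (entry_time N + 1).
    by rewrite addn1 leq_mul2r le_n orbT.
  by rewrite /row_time; lia.
have start : upd (pos (n - k.+1) k 0 0) 6 n = pos (n - k.+1) k n 0 by rewrite /pos; upd_eq.
rewrite start in run2.
apply: exec_eq
  (exec_seq run1 (exec_seq run2 (exec_seq run3 (exec_seq run4 (exec_inc _ _ _ _))))) _.
by rewrite /pos; upd_eq.
Qed.

Lemma exec_matrix : exists2 t, t <= matrix_time N &
  exists2 st, st.2 = matrix_word n a &
    exec (contents w g) matrix_prog t (guess_store (size w)) st.
Proof.
have le_n := dim_leq; have [t1 le_t1 run1] := exec_prelude w g.
have [//|_ [t2 le_t2 run2]] := exec_dim [::] (ready_clean_pos w (ltnSn 3)).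
have [||k lt_k|t3 le_t3 run3] := @exec_loop (contents w g) 4 row_prog
  (fun k => (pos (n - k) k 0 0, [seq a u v | u <- iota 0 k, v <- iota 0 n])) n (row_time N).
- by move=> x; apply: contents_mark.
- by [].
- by rewrite matrix_rowsS; apply: exec_row.
rewrite subn0 in run3.
have start : upd (clean_pos w) 4 n = pos n 0 0 0 by rewrite /pos; upd_eq.
rewrite start in run2.
exists (t1 + t2 + t3); last first.
  by eexists; last exact: exec_seq (exec_seq run1 run2) run3; first by [].
rewrite /matrix_time !leq_add // (leq_trans le_t3) // leq_add2r addn1.
by rewrite leq_mul2r le_n orbT.
Qed.

End MatrixProgram.

Theorem polytime_matrix (dim : seq bool -> nat) (a : seq bool -> nat -> nat -> bool) :
  numeric (fun w _ _ => dim w) -> definable (fun w _ e => a w (e 1) (e 0)) ->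
  polytime_computable (fun w => matrix_word (dim w) (a w)).
Proof.
move=> [ed edE] [ea eaE].
have [Td [Vd [pTd pVd cd]]] := compileP ed; have [Te [Ve [pTe pVe ce]]] := compileP ea.
have run w g := exec_matrix cd ce (edE w g) (fun u v => eaE w g _).
exists (guess_machine (matrix_prog ed ea) (pred1 false) 4); split.
- by apply: guess_machine_deterministic => b b' /eqP-> /eqP->.
- apply: (@polytime_guess_machine _ _ _ (matrix_time Td Vd Te)).
    by rewrite /matrix_time /row_time /entry_time; poly_bound.
  by move=> w g _ _; have [t le_t [st _ run_g]] := run w g; exists t, st.
- move=> w; pose g := nseq (size w) false; have [t _ [st <- run_g]] := run w g.
  have [||c [wc c_st cq]] := exec_nsteps (guessable := pred1 false) 4 _ _ run_g.
  + exact: size_nseq.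
  + by apply/allP => b; rewrite mem_nseq => /andP[_].
  exists (size w + t + 3), c; split=> //; first exact: halted_verdict cq.
  exact: store_represents_output c_st.
Qed.

(** * Membership in NP *)

Lemma pairwise_sym_in (T : eqType) (E : rel T) s : symmetric E -> pairwise E s ->
  {in s &, forall u v, u != v -> E u v}.
Proof.
move=> symE; elim: s => // x s IH /= /andP[/allP xE /IH sE] u v.
rewrite !inE => /predU1P[->|su] /predU1P[->|sv]; first by rewrite eqxx.
- by move=> _; apply: xE.
- by move=> _; rewrite symE; apply: xE.
- exact: sE.
Qed.

Lemma clique_number_leP (V : finType) (E : rel V) m : symmetric E -> irreflexive E ->
  reflect (forall s : seq V, size s = m.+1 -> ~~ pairwise E s) (clique_number E <= m).
Proof.
move=> symE irrE; apply: (iffP idP) => [le_m s sz|no_clique].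
  apply/negP => sE; have cliqueS : is_clique E [set x in s].
    apply/forall_inP => u; rewrite inE => su; apply/forall_inP => v; rewrite inE => sv.
    by apply/implyP; apply: (pairwise_sym_in symE sE).
  have := leq_trans (leq_bigmax_cond (F := fun S : {set V} => #|S|) _ cliqueS) le_m.
  by rewrite cardsE (card_uniqP (pairwise_uniq irrE sE)) sz ltnn.
apply/bigmax_leqP => S /forall_inP cliqueS; rewrite leqNgt; apply/negP => lt_m.
have sub : subseq (take m.+1 (enum S)) (enum S) by apply: take_subseq.
have := no_clique (take m.+1 (enum S)); rewrite size_takel -?cardE // => /(_ erefl)/negP.
apply; apply: (sub_in_pairwise (P := mem S) (r := fun u v => u != v)).
- by move=> u v Su Sv; apply/implyP; apply: (forall_inP (cliqueS u Su)).
- by apply/allP => u /(mem_subseq sub); rewrite mem_enum.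
- by rewrite -uniq_pairwise (subseq_uniq sub) ?enum_uniq.
Qed.

Definition order_of (V : finType) (f : V -> nat) : {set V * V} := [set p | f p.1 < f p.2].

Lemma order_of_strict (V : finType) (f : V -> nat) :
  injective f -> strict_total_order (order_of f).
Proof.
move=> inj; apply/and3P; split.
- by apply/forallP => u; rewrite inE ltnn.
- do 3 apply/forallP => ?; rewrite !inE /=.
  by apply/implyP => /andP[]; apply: ltn_trans.
- do 2 apply/forallP => ?; rewrite !inE /=; apply/implyP => neq_uv.
  by rewrite -neq_ltn; apply: contra neq_uv => /eqP/inj->.
Qed.

Lemma diomega_le (V : finType) (A : rel V) r :
  strict_total_order r -> diomega A <= clique_number (backedge A r).
Proof.
exact: (@Order.TotalTheory.bigmin_le_cond _ nat _ _ r _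
  (fun r => clique_number (backedge A r))).
Qed.

Lemma diomega_attained (V : finType) (A : rel V) :
  exists2 r, strict_total_order r & diomega A = clique_number (backedge A r).
Proof.
have rankP : strict_total_order (order_of (fun x : V => enum_rank x : nat)).
  by apply: order_of_strict => x y /ord_inj/enum_rank_inj.
have [r|r rP omegaE] := @Order.TotalTheory.eq_bigmin _ nat _ #|V| _ _
  (fun r => clique_number (backedge A r)) rankP.
  by move=> _; apply/bigmax_leqP => S _; apply: max_card.
by exists r => //; apply: omegaE.
Qed.

Definition matrix_entry (n : nat) (w : seq bool) (u v : nat) : bool :=
  nth false w (u * n + v).

Lemma size_matrix_word n a : size (matrix_word n a) = n * n.
Proof. by rewrite size_allpairs !size_iota. Qed.

Lemma matrix_wordK n a : {in gtn n &, matrix_entry n (matrix_word n a) =2 a}.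
Proof.
move=> u v + lt_vn; rewrite /matrix_entry /matrix_word !inE in lt_vn *.
move: {1 3}n; elim=> // k IH lt_uk.
rewrite matrix_rowsS nth_cat size_allpairs !size_iota.
case: (ltnP u k) => [lt_u|le_ku]; first by rewrite ifT; [exact: IH | nia].
have -> : u = k by lia.
by rewrite ltnNge leq_addr addKn nth_mkseq.
Qed.

Lemma matrix_entryK n w : size w = n * n -> matrix_word n (matrix_entry n w) = w.
Proof.
move=> sz; apply: (@eq_from_nth _ false); rewrite size_matrix_word // => i lt_i.
have n_gt0 : 0 < n by case: (n) lt_i.
rewrite (divn_eq i n) -[LHS]/(matrix_entry n _ (i %/ n) (i %% n)) matrix_wordK //.
  by rewrite inE ltn_divLR.
by rewrite inE ltn_mod.
Qed.

Lemma all_iotaP n (P : pred nat) : reflect (forall u, u < n -> P u) (all P (iota 0 n)).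
Proof.
by apply: (iffP allP) => PP u; [move=> lt_un; apply: PP; rewrite mem_iota
                               | rewrite mem_iota; apply: PP].
Qed.

Lemma all_gtnP n (s : seq nat) : all (gtn n) s -> exists s' : seq 'I_n, s = map val s'.
Proof.
elim: s => [|u s IH] /=; first by exists [::].
by case/andP=> lt_un /IH[s' ->]; exists (Ordinal lt_un :: s').
Qed.

Definition tournament_below (n : nat) (a : rel nat) : bool :=
  all (fun u => ~~ a u u && all (fun v => (u == v) || (a u v (+) a v u))
    (iota 0 n)) (iota 0 n).

Definition strict_order_below (n : nat) (lt : rel nat) : bool :=
  all (fun u => ~~ lt u u && all (fun v => ((u == v) || (lt u v || lt v u)) &&
    all (fun x => lt u v && lt v x ==> lt u x) (iota 0 n)) (iota 0 n)) (iota 0 n).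

Definition K4_free_below (n : nat) (E : rel nat) : bool :=
  all (fun u => all (fun v => all (fun x => all (fun y => ~~ pairwise E [:: u; v; x; y])
    (iota 0 n)) (iota 0 n)) (iota 0 n)) (iota 0 n).

Definition nat_backedge (a lt : rel nat) : rel nat :=
  fun u v => lt u v && a v u || lt v u && a u v.

Definition good_order (n : nat) (a lt : rel nat) : bool :=
  strict_order_below n lt && K4_free_below n (nat_backedge a lt).

Lemma tournament_belowP n a : reflect
  ((forall u, u < n -> ~~ a u u) /\
   (forall u v, u < n -> v < n -> u != v -> a u v (+) a v u))
  (tournament_below n a).
Proof.
apply: (iffP (all_iotaP _ _)) => [tour|[irr tour] u lt_un].
  split=> [u /tour/andP[]//|u v /tour/andP[_ /all_iotaP rowu] /rowu/orP[|//]].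
  by move=> ->.
rewrite irr //; apply/all_iotaP => v lt_vn.
by case: (eqVneq u v) => // /tour->.
Qed.

Lemma strict_order_belowP n lt : reflect
  [/\ forall u, u < n -> ~~ lt u u,
      forall u v, u < n -> v < n -> u != v -> lt u v || lt v u &
      forall u v x, u < n -> v < n -> x < n -> lt u v -> lt v x -> lt u x]
  (strict_order_below n lt).
Proof.
apply: (iffP (all_iotaP _ _)) => [ord|[irr total trans] u lt_un].
  split=> [u /ord/andP[]//|u v|u v x] /ord/andP[_ /all_iotaP rowu] /rowu/andP[].
    by case/orP=> [->|].
  by move=> _ /all_iotaP entry /entry/implyP trans uv vx; apply: trans; rewrite uv.
rewrite irr //; apply/all_iotaP => v lt_vn; apply/andP; split.
  by case: (eqVneq u v) => // /total->.
by apply/all_iotaP => x lt_xn; apply/implyP => /andP[]; apply: trans.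
Qed.

Lemma K4_free_belowP n E : reflect
  (forall s, size s = 4 -> all (gtn n) s -> ~~ pairwise E s) (K4_free_below n E).
Proof.
apply: (iffP (all_iotaP _ _)) => [free s|free u lt_un].
  case: s => [|u [|v [|x [|y [|z s]]]]] // _ /and5P[/free/all_iotaP rowu].
  by move=> /rowu/all_iotaP rowv /rowv/all_iotaP rowx /rowx.
apply/all_iotaP => v lt_vn; apply/all_iotaP => x lt_xn; apply/all_iotaP => y lt_yn.
by apply: free => //=; rewrite lt_un lt_vn lt_xn lt_yn.
Qed.

Lemma eq_in_tournament_below n a a' : {in gtn n &, a =2 a'} ->
  tournament_below n a -> tournament_below n a'.
Proof.
move=> eqa /tournament_belowP[irr tour]; apply/tournament_belowP.
by split=> [u lt_u|u v lt_u lt_v]; rewrite -!eqa //; [apply: irr | apply: tour].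
Qed.

Lemma eq_in_good_order n a a' lt lt' : {in gtn n &, a =2 a'} -> {in gtn n &, lt =2 lt'} ->
  good_order n a lt -> good_order n a' lt'.
Proof.
move=> eqa eqlt /andP[/strict_order_belowP[irr total trans] /K4_free_belowP free].
apply/andP; split; [apply/strict_order_belowP; split | apply/K4_free_belowP].
- by move=> u lt_u; rewrite -eqlt //; apply: irr.
- by move=> u v lt_u lt_v; rewrite -!eqlt //; apply: total.
- by move=> u v x lt_u lt_v lt_x; rewrite -!eqlt //; apply: trans.
move=> s sz s_lt; rewrite -(eq_in_pairwise (P := gtn n) (r := nat_backedge a lt)) ?free //.
by move=> u v lt_u lt_v; rewrite /nat_backedge !eqa ?eqlt.
Qed.

Definition nat_rel (n : nat) (A : rel 'I_n) (u v : nat) : bool :=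
  match insub u, insub v with Some x, Some y => A x y | _, _ => false end.

Lemma nat_relE n (A : rel 'I_n) (u v : 'I_n) : nat_rel A u v = A u v.
Proof. by rewrite /nat_rel !valK. Qed.

Lemma encode_tournamentE n (A : rel 'I_n) (a : rel nat) :
  (forall u v : 'I_n, a u v = A u v) -> encode_tournament A = matrix_word n a.
Proof.
move=> aA; rewrite /matrix_word -val_enum_ord allpairs_mapl allpairs_mapr.
by apply: eq_allpairs => u v; rewrite aA.
Qed.

Lemma tournament_below_ord n (A : rel 'I_n) (a : rel nat) :
  (forall u v : 'I_n, a u v = A u v) -> is_tournament A <-> tournament_below n a.
Proof.
move=> aA; split=> [[irr tour]|/tournament_belowP[irr tour]].
  apply/tournament_belowP; split=> [u lt_u|u v lt_u lt_v].
    by have := irr (Ordinal lt_u); rewrite -aA /= => ->.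
  by have := tour (Ordinal lt_u) (Ordinal lt_v); rewrite -!aA; apply.
split=> [u|u v neq_uv]; rewrite -!aA; last exact: tour.
by apply: negbTE; apply: irr.
Qed.

Lemma good_order_ord n (A : rel 'I_n) (r : {set 'I_n * 'I_n}) (a lt : rel nat) :
  (forall u v : 'I_n, a u v = A u v) -> (forall u v : 'I_n, lt u v = ((u, v) \in r)) ->
  good_order n a lt = strict_total_order r && (clique_number (backedge A r) <= 3).
Proof.
move=> aA ltr; have symE : symmetric (backedge A r) by move=> u v; rewrite /backedge orbC.
have strictE : strict_order_below n lt = strict_total_order r.
  apply/strict_order_belowP/and3P => [[irr total trans]|[irr trans total]]; split.
  - by apply/forallP => u; rewrite -ltr; apply: irr.
  - by do 3 apply/forallP => ?; rewrite -!ltr; apply/implyP => /andP[];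
      apply: trans; apply: ltn_ord.
  - by do 2 apply/forallP => ?; rewrite -!ltr; apply/implyP;
      apply: total; apply: ltn_ord.
  - by move=> u lt_u; rewrite (ltr (Ordinal lt_u) (Ordinal lt_u)); apply: (forallP irr).
  - move=> u v lt_u lt_v.
    rewrite (ltr (Ordinal lt_u) (Ordinal lt_v)) (ltr (Ordinal lt_v) (Ordinal lt_u)).
    exact/implyP/(forallP (forallP total (Ordinal lt_u)) (Ordinal lt_v)).
  - move=> u v x lt_u lt_v lt_x; rewrite (ltr (Ordinal lt_u) (Ordinal lt_v)).
    rewrite (ltr (Ordinal lt_v) (Ordinal lt_x)) (ltr (Ordinal lt_u) (Ordinal lt_x)) => uv vx.
    apply: (implyP (forallP (forallP (forallP trans (Ordinal lt_u)) (Ordinal lt_v))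
      (Ordinal lt_x))).
    by rewrite uv.
rewrite /good_order strictE; case rP: (strict_total_order r) => //=.
have irrE : irreflexive (backedge A r).
  by case/and3P: rP => /forallP irr _ _ u; rewrite /backedge (negbTE (irr u)).
have edgeE (s : seq 'I_n) :
    pairwise (nat_backedge a lt) (map val s) = pairwise (backedge A r) s.
  rewrite pairwise_map; apply: eq_pairwise => u v /=.
  by rewrite /nat_backedge /backedge -!ltr -!aA.
apply/K4_free_belowP/(clique_number_leP 3 symE irrE) => free s sz.
  rewrite -edgeE free ?size_map //.
  by apply/allP => _ /mapP[u _ ->]; rewrite inE ltn_ord.
case/all_gtnP=> s' sE; rewrite sE edgeE free //.
by rewrite sE size_map in sz.
Qed.

Lemma three_diomega_orderP w : three_diomega_ordering w <-> exists n a,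
  [/\ tournament_below n a, w = matrix_word n a & exists lt, good_order n a lt].
Proof.
split=> [[n [A [tour -> le3]]]|[n [a [tour -> [lt lt_good]]]]].
  have [r rP omegaE] := diomega_attained A.
  exists n, (nat_rel A); split; last exists (nat_rel (fun u v => (u, v) \in r)).
  - by rewrite -(tournament_below_ord (nat_relE A)).
  - exact: encode_tournamentE (nat_relE A).
  - by rewrite (good_order_ord (nat_relE A) (nat_relE _)) rP -omegaE.
pose A : rel 'I_n := fun u v => a u v.
pose r := [set p : 'I_n * 'I_n | lt p.1 p.2].
have aA (u v : 'I_n) : a u v = A u v by [].
exists n, A; split; [exact/(tournament_below_ord aA) | by rewrite (encode_tournamentE aA) |].
have := lt_good; rewrite (good_order_ord (r := r) aA) => [/andP[rP]|u v]; last by rewrite inE.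
exact: leq_trans (diomega_le A rP).
Qed.

Lemma three_diomega_matrix n a : tournament_below n a ->
  three_diomega_ordering (matrix_word n a) <-> exists lt, good_order n a lt.
Proof.
move=> tour; rewrite three_diomega_orderP; split=> [[m [b [_ abE [lt lt_good]]]]|[lt lt_good]].
  have nm : n = m by have := congr1 size abE; rewrite !size_matrix_word; nia.
  subst m; exists lt; apply: eq_in_good_order lt_good => // u v lt_un lt_vn.
  by rewrite -(matrix_wordK b lt_un lt_vn) -abE (matrix_wordK a lt_un lt_vn).
by exists n, a; split=> //; exists lt.
Qed.

Definition verify (w g : seq bool) : bool :=
  has (fun n => [&& n * n == size w, tournament_below n (matrix_entry n w)
                  & good_order n (matrix_entry n w) (matrix_entry n g)])
    (iota 0 (size w + 1)).

Lemma definable_verify : definable (fun w g _ => verify w g).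
Proof.
rewrite /verify /good_order /tournament_below /strict_order_below /K4_free_below.
by rewrite /nat_backedge /matrix_entry /=; numeric.
Qed.

Lemma three_diomega_verify w :
  three_diomega_ordering w <-> exists2 g, size g = size w & verify w g.
Proof.
rewrite three_diomega_orderP; split=> [[n [a [tour -> [lt lt_good]]]]|[g _ /hasP[n _]]].
  exists (matrix_word n lt); rewrite ?size_matrix_word //; apply/hasP; exists n.
    by rewrite mem_iota size_matrix_word; nia.
  have wordK b : {in gtn n &, b =2 matrix_entry n (matrix_word n b)}.
    by move=> u v lt_un lt_vn; rewrite (matrix_wordK b lt_un lt_vn).
  by rewrite size_matrix_word eqxx (eq_in_tournament_below (wordK a))
    ?(eq_in_good_order (wordK a) (wordK lt)).
case/and3P=> /eqP sz tour g_good; exists n, (matrix_entry n w).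
by split=> //; [rewrite matrix_entryK | exists (matrix_entry n g)].
Qed.

Lemma eq_in_NP L L' : (forall w, L w <-> L' w) -> in_NP L -> in_NP L'.
Proof. by move=> eqL [M [pM hM]]; exists M; split=> // w; rewrite -eqL. Qed.

Lemma three_diomega_in_NP : in_NP three_diomega_ordering.
Proof.
apply: eq_in_NP (in_NP_definable definable_verify) => w.
by rewrite three_diomega_verify.
Qed.

(** * From tournament orders to acyclic 2-colourings *)

(* The arcs of the tournament whose backedges in the natural order are given by [bk],
   which is only used on pairs [u < v]. *)
Definition arc_of (bk : rel nat) : rel nat :=
  fun u v => if u < v then ~~ bk u v else (v < u) && bk v u.

Lemma arc_of_irr bk u : ~~ arc_of bk u u.
Proof. by rewrite /arc_of ltnn. Qed.

Lemma arc_of_total bk u v : u != v -> arc_of bk u v (+) arc_of bk v u.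
Proof. by rewrite /arc_of; case: ltngtP => // _ _; case: bk. Qed.

Lemma arc_of_asym bk u v : arc_of bk u v -> ~~ arc_of bk v u.
Proof.
move=> uv; have : u != v by apply: contraTneq uv => <-; apply: arc_of_irr.
by move/(arc_of_total bk); rewrite uv.
Qed.

Lemma arc_of_tournament n bk : tournament_below n (arc_of bk).
Proof.
by apply/tournament_belowP; split=> *; [apply: arc_of_irr | apply: arc_of_total].
Qed.

Definition acyclic_coloring (n : nat) (a : rel nat) (c : nat -> bool) :=
  forall x y z, x < n -> y < n -> z < n -> a x y -> a y z -> a z x ->
  ~ (c x = c y /\ c y = c z).

Definition class_rank (n : nat) (a : rel nat) (c : nat -> bool) (x : nat) : nat :=
  #|[set y : 'I_n | (c y == c x) && a y x]|.

Lemma class_rank_leq n a c x : class_rank n a c x <= n.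
Proof. by rewrite -[leqRHS]card_ord max_card. Qed.

Section ClassRank.
Variables (n : nat) (a : rel nat) (c : nat -> bool).
Hypotheses (tour : tournament_below n a) (acyclic : acyclic_coloring n a c).

Lemma class_rank_arc x y : x < n -> y < n -> c x = c y -> a x y ->
  class_rank n a c x < class_rank n a c y.
Proof.
have /tournament_belowP[irr total] := tour.
move=> lt_xn lt_yn cxy xy.
have neq_xy : x != y by apply: contraTneq xy => <-; apply: irr.
have not_yx : ~~ a y x by have := total x y lt_xn lt_yn neq_xy; rewrite xy.
apply: proper_card; apply/properP; split.
  apply/subsetP => z; rewrite !inE cxy => /andP[czy zx]; rewrite czy /=.
  have neq_zy : z != y :> nat by apply: contraTneq zx => ->.
  have := total z y (ltn_ord z) lt_yn neq_zy; case: (a z y) => //= yz.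
  by case: (acyclic lt_xn lt_yn (ltn_ord z) xy yz zx); rewrite (eqP czy) cxy.
by exists (Ordinal lt_xn); rewrite !inE /= ?cxy ?eqxx ?xy // (negbTE (irr _ _)) ?andbF.
Qed.

Lemma class_rank_lt x y : x < n -> y < n -> c x = c y ->
  (class_rank n a c x < class_rank n a c y) = a x y.
Proof.
have /tournament_belowP[_ total] := tour.
move=> lt_xn lt_yn cxy; apply/idP/idP => [lt_rank|]; last exact: class_rank_arc.
have neq_xy : x != y by apply: contraTneq lt_rank => ->; rewrite ltnn.
have := total x y lt_xn lt_yn neq_xy; case yx: (a y x); rewrite ?addbF //.
by have := class_rank_arc lt_yn lt_xn (esym cxy) yx; lia.
Qed.

Lemma class_rank_inj x y : x < n -> y < n -> c x = c y ->
  class_rank n a c x = class_rank n a c y -> x = y.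
Proof.
have /tournament_belowP[_ total] := tour.
move=> lt_xn lt_yn cxy eq_rank; apply/eqP/negPn/negP => /(total x y lt_xn lt_yn).
by rewrite -!class_rank_lt // eq_rank ltnn.
Qed.

End ClassRank.

(* The backedges of a 7-vertex tournament in the natural order: they form a
   triangle-free graph, but the tournament is not the union of two transitive ones.
   It was found by computer search. *)
Definition r7_back (u v : nat) : bool :=
  v \in nth [::] [:: [:: 2; 3; 5]; [:: 3; 6]; [:: 4; 6]; [:: 4]; [:: 5]; [:: 6]; [::]] u.

Definition r7_adj (u v : nat) : bool := r7_back u v || r7_back v u.

Lemma r7_triangle_free u v x : u < 7 -> v < 7 -> x < 7 ->
  r7_adj u v -> r7_adj u x -> r7_adj v x -> False.
Proof.
have : all (fun u => all (fun v => all (fun x => ~~ [&& r7_adj u v, r7_adj u x & r7_adj v x])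
  (iota 0 7)) (iota 0 7)) (iota 0 7) by vm_compute.
move=> /all_iotaP free /free/all_iotaP freeu /freeu/all_iotaP freev /freev + uv ux vx.
by rewrite uv ux vx.
Qed.

Lemma r7_not_acyclic c : ~ acyclic_coloring 7 (arc_of r7_back) c.
Proof.
move=> acyclic; pose mono s := has (fun i => has (fun j => has (fun k =>
    [&& arc_of r7_back i j, arc_of r7_back j k, arc_of r7_back k i,
        nth false s i == nth false s j & nth false s j == nth false s k])
  (iota 0 7)) (iota 0 7)) (iota 0 7).
have : mono (mkseq c 7).
  rewrite /mkseq /=; move: (c 0) (c 1) (c 2) (c 3) (c 4) (c 5) (c 6).
  by do 7!case; vm_compute.
case/hasP=> i + /hasP[j + /hasP[k]]; rewrite !mem_iota => lt_i lt_j lt_k.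
rewrite !nth_mkseq // => /and5P[ij jk ki /eqP cij /eqP cjk].
exact: acyclic ij jk ki (conj cij cjk).
Qed.

Section Gadget.
(* [bkV] gives the backedges of a tournament [V] on [nV] vertices. The vertices
   [0..6] and [7..13] form two copies [R2 => R1] of the 7-vertex tournament, and
   [V], shifted by 14, satisfies [R1 => V => R2]. *)
Variables (nV : nat) (bkV : rel nat).

Definition gadget_back (u v : nat) : bool :=
  if v < 7 then r7_back u v
  else if u < 7 then 14 <= v
  else if v < 14 then r7_back (u - 7) (v - 7)
  else if u < 14 then false
  else bkV (u - 14) (v - 14).

Notation A := (arc_of gadget_back).
Notation n := (14 + nV).

Lemma arc_R o u v : o = 0 \/ o = 7 -> u < 7 -> v < 7 -> A (o + u) (o + v) = arc_of r7_back u v.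
Proof.
move=> oE lt_u lt_v; rewrite /arc_of /gadget_back !ltn_add2l.
case: oE => ->; first by rewrite lt_u lt_v.
have bounds x : x < 7 -> (7 + x < 7) = false /\ (7 + x < 14) = true by lia.
by have [-> ->] := bounds u lt_u; have [-> ->] := bounds v lt_v; rewrite !addKn.
Qed.

Lemma arc_R2_R1 u v : u < 7 -> v < 7 -> A u (7 + v).
Proof. by move=> lt_u lt_v; rewrite /arc_of /gadget_back; repeat case: ifP; lia. Qed.

Lemma arc_R1_V u v : u < 7 -> A (7 + u) (14 + v).
Proof. by move=> lt_u; rewrite /arc_of /gadget_back; repeat case: ifP; lia. Qed.

Lemma arc_V_R2 u v : v < 7 -> A (14 + u) v.
Proof. by move=> lt_v; rewrite /arc_of /gadget_back; repeat case: ifP; lia. Qed.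

Lemma arc_V u v : A (14 + u) (14 + v) = arc_of bkV u v.
Proof.
rewrite /arc_of /gadget_back !addKn !ltn_add2l.
by have below x k : k <= 14 -> (14 + x < k) = false by [lia]; rewrite !below.
Qed.

Section FromOrder.
Variable lt : rel nat.
Hypothesis lt_good : good_order n A lt.
Let E := nat_backedge A lt.

Lemma no_K4 u v x y : u < n -> v < n -> x < n -> y < n ->
  E u v -> E u x -> E u y -> E v x -> E v y -> E x y -> False.
Proof.
case/andP: lt_good => _ /K4_free_belowP free lt_u lt_v lt_x lt_y uv ux uy vx vy xy.
have := free [:: u; v; x; y] erefl; rewrite /= lt_u lt_v lt_x lt_y => /(_ isT).
by rewrite -!/(E _ _) uv ux uy vx vy xy.
Qed.

Lemma not_edge_lt u v : u < n -> v < n -> A u v -> ~~ E u v -> lt u v.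
Proof.
have /andP[/strict_order_belowP[_ total _] _] := lt_good => lt_u lt_v uv.
rewrite /E /nat_backedge negb_or uv andbT => /andP[_ not_vu].
have : u != v by apply: contraTneq uv => <-; apply: arc_of_irr.
by move=> /(total u v lt_u lt_v); rewrite (negbTE not_vu) orbF.
Qed.

Lemma cycle_edge u v x : u < n -> v < n -> x < n -> A u v -> A v x -> A x u ->
  [|| E u v, E v x | E x u].
Proof.
have /andP[/strict_order_belowP[irr _ trans] _] := lt_good => lt_u lt_v lt_x uv vx xu.
apply: contraT => /norP[not_uv /norP[not_vx not_xu]].
have luv := not_edge_lt lt_u lt_v uv not_uv; have lvx := not_edge_lt lt_v lt_x vx not_vx.
have lxu := not_edge_lt lt_x lt_u xu not_xu.
by have := irr u lt_u; rewrite (trans u x u) // (trans u v x).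
Qed.

Lemma mono_edge_R o (f : nat -> bool) : o = 0 \/ o = 7 ->
  exists i j, [/\ i < 7, j < 7, E (o + i) (o + j) & f (o + i) = f (o + j)].
Proof.
move=> oE; pose mono i j := E (o + i) (o + j) && (f (o + i) == f (o + j)).
have lt_on i : i < 7 -> o + i < n by case: oE => ->; lia.
have : has (fun i => has (mono i) (iota 0 7)) (iota 0 7).
  apply/negPn/negP => none; apply: (r7_not_acyclic (c := fun i => f (o + i))).
  have no_mono i j : i < 7 -> j < 7 -> f (o + i) = f (o + j) -> E (o + i) (o + j) = false.
    move=> lt_i lt_j fij; apply: contraNF none => ij; apply/hasP; exists i; rewrite ?mem_iota //.
    by apply/hasP; exists j; rewrite ?mem_iota // /mono ij fij eqxx.
  move=> i j k lt_i lt_j lt_k; rewrite -!(arc_R oE) // => ij jk ki [fij fjk].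
  have := cycle_edge (lt_on i lt_i) (lt_on j lt_j) (lt_on k lt_k) ij jk ki.
  by rewrite !no_mono // -fjk.
case/hasP=> i + /hasP[j + /andP[ij /eqP fij]]; rewrite !mem_iota => lt_i lt_j.
by exists i, j.
Qed.

Definition low (x : nat) : bool :=
  has (fun i => has (fun j =>
    [&& lt (14 + x) (7 + i), lt (14 + x) (7 + j) & E (7 + i) (7 + j)])
  (iota 0 7)) (iota 0 7).

Lemma lowP x : reflect (exists i j, [/\ i < 7, j < 7, lt (14 + x) (7 + i),
  lt (14 + x) (7 + j) & E (7 + i) (7 + j)]) (low x).
Proof.
apply: (iffP hasP) => [[i + /hasP[j + /and3P[xi xj ij]]]|[i [j [lt_i lt_j xi xj ij]]]].
  by rewrite !mem_iota => lt_i lt_j; exists i, j.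
by exists i; rewrite ?mem_iota //; apply/hasP; exists j; rewrite ?mem_iota // xi xj.
Qed.

Lemma not_low_edge_before x : x < nV -> ~~ low x -> exists i j,
  [/\ i < 7, j < 7, lt i (14 + x), lt j (14 + x) & E i j].
Proof.
have /andP[/strict_order_belowP[_ total trans] _] := lt_good => lt_x not_low.
have before i : i < 14 -> lt (14 + x) i = false -> lt i (14 + x).
  by move=> lt_i not_after; have := total i (14 + x); rewrite not_after orbF; apply; lia.
have [i [j [lt_i lt_j ij fij]]] := mono_edge_R (lt (14 + x)) (or_intror erefl).
case fj: (lt (14 + x) (7 + j)) fij => fi; first by case/lowP: not_low; exists i, j.
have {}fi : lt (7 + i) (14 + x) by apply: before; [lia|].
have {}fj : lt (7 + j) (14 + x) by apply: before; [lia|].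
have [k [l [lt_k lt_l kl fkl]]] := mono_edge_R (lt (14 + x)) (or_introl erefl).
rewrite !add0n in kl fkl.
case fl: (lt (14 + x) l) fkl => fk; last first.
  by exists k, l; split=> //; apply: before => //; lia.
have cross a b : a < 7 -> b < 7 -> lt (7 + a) (14 + x) -> lt (14 + x) b -> E (7 + a) b.
  by move=> lt_a lt_b ax xb; rewrite /E /nat_backedge (trans _ (14 + x)) ?arc_R2_R1 //; lia.
by case: (@no_K4 (7 + i) (7 + j) k l) => //; by [apply: cross | lia].
Qed.

Lemma same_low_no_edge x y : x < nV -> y < nV -> low x = low y ->
  E (14 + x) (14 + y) = false.
Proof.
have /andP[/strict_order_belowP[_ _ trans] _] := lt_good.
wlog lxy : x y / lt (14 + x) (14 + y) => [wlog_lt|] lt_x lt_y low_xy.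
  apply/negP => xy; case/orP: (xy) => /andP[l _]; first by rewrite wlog_lt in xy.
  by move: xy; rewrite /E /nat_backedge orbC -/(nat_backedge A lt _ _) -/E wlog_lt.
apply/negP => xy; case low_y: (low y) low_xy => low_x.
  have /lowP[i [j [lt_i lt_j yi yj ij]]] := low_y.
  have edge a b : a < nV -> b < 7 -> lt (14 + a) (7 + b) -> E (14 + a) (7 + b).
    by move=> _ lt_b ab; rewrite /E /nat_backedge ab arc_R1_V.
  have after k : k < 7 -> lt (14 + y) (7 + k) -> lt (14 + x) (7 + k).
    by move=> lt_k; apply: trans lxy; lia.
  by case: (@no_K4 (14 + x) (14 + y) (7 + i) (7 + j)) => //;
    by [apply: edge => //; apply: after | apply: edge | lia].
have [i [j [lt_i lt_j ix jx ij]]] := not_low_edge_before lt_x (negbT low_x).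
have edge a b : a < nV -> b < 7 -> lt b (14 + a) -> E (14 + a) b.
  by move=> _ lt_b ba; rewrite /E /nat_backedge ba arc_V_R2 ?orbT.
have before k : k < 7 -> lt k (14 + x) -> lt k (14 + y).
  by move=> lt_k kx; apply: trans kx lxy; lia.
by case: (@no_K4 (14 + x) (14 + y) i j) => //;
  by [apply: edge => //; apply: before | apply: edge | lia].
Qed.

Lemma low_acyclic : acyclic_coloring nV (arc_of bkV) low.
Proof.
move=> x y z lt_x lt_y lt_z; rewrite -!arc_V => xy yz zx [low_xy low_yz].
have : [|| E (14 + x) (14 + y), E (14 + y) (14 + z) | E (14 + z) (14 + x)].
  by apply: cycle_edge xy yz zx; lia.
by rewrite !same_low_no_edge // -low_yz.
Qed.

End FromOrder.

Section FromColoring.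
Variable c : nat -> bool.
Hypothesis acyclic : acyclic_coloring nV (arc_of bkV) c.

Notation class_rank := (class_rank nV (arc_of bkV) c).

(* In increasing order: colour [true], [R2], [R1], colour [false]. *)
Definition gadget_rank (u : nat) : nat :=
  if u < 14 then nV.+1 + u
  else if c (u - 14) then class_rank (u - 14) else nV.+1 + 14 + class_rank (u - 14).

Let lt : rel nat := fun u v => gadget_rank u < gadget_rank v.
Let E := nat_backedge A lt.

(* [R1] and colour [false] *)
Let upper u := if u < 14 then 7 <= u else ~~ c (u - 14).

Let tourV := arc_of_tournament nV bkV.

Lemma gadget_rank_inj u v : u < n -> v < n -> gadget_rank u = gadget_rank v -> u = v.
Proof.
move=> lt_u lt_v; rewrite /gadget_rank.
have := class_rank_leq nV (arc_of bkV) c (u - 14).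
have := class_rank_leq nV (arc_of bkV) c (v - 14).
have inj := @class_rank_inj nV _ c tourV acyclic (u - 14) (v - 14).
case: (ltnP u 14) => u14; case: (ltnP v 14) => v14; try by [case: (c _); lia | lia].
case: (c (u - 14)) inj; case: (c (v - 14)) => inj le_v le_u eq_rank;
  by [lia | have := inj ltac:(lia) ltac:(lia) erefl ltac:(lia); lia].
Qed.

Lemma edge_upper u v : u < n -> v < n -> E u v ->
  (upper u == upper v) = (u < 14) && (v < 14).
Proof.
wlog [luv vu] : u v / lt u v /\ A v u.
  move=> wlog_lt lt_u lt_v /orP[/andP[luv vu]|/andP[lvu uv]]; last rewrite eq_sym andbC.
    by apply: wlog_lt; rewrite // /E /nat_backedge luv vu.
  by apply: wlog_lt; rewrite // /E /nat_backedge lvu uv.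
move=> lt_u lt_v _; have not_uv := arc_of_asym vu.
move: luv; rewrite /lt /gadget_rank /upper.
have := class_rank_leq nV (arc_of bkV) c (u - 14).
have := class_rank_leq nV (arc_of bkV) c (v - 14).
case: (ltnP u 14) => u14; case: (ltnP v 14) => v14 le_v le_u /=.
- move=> luv; have lt_uv : u < v by lia.
  case: (leqP 7 u) => u7; first by have -> : 7 <= v by lia.
  case: (leqP 7 v) => // v7; case/negP: not_uv.
  by rewrite -(subnKC v7); apply: arc_R2_R1; lia.
- case: (c _) => /=; first by lia.
  case: (leqP 7 u) => // u7; case/negP: not_uv.
  by rewrite -(subnKC u7) -(subnKC v14); apply: arc_R1_V; lia.
- case: (c _) => /=; last by lia.
  case: (leqP 7 v) => // v7; case/negP: not_uv.
  by rewrite -(subnKC u14); apply: arc_V_R2.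
- have not_uvV : ~~ arc_of bkV (u - 14) (v - 14) by rewrite -arc_V !subnKC.
  have := @class_rank_lt nV _ c tourV acyclic (u - 14) (v - 14).
  rewrite (negbTE not_uvV).
  case: (c (u - 14)); case: (c (v - 14)) => //= same luv;
    by have := same ltac:(lia) ltac:(lia) erefl; lia.
Qed.

Lemma edge_R o u v : o = 0 \/ o = 7 -> u < 7 -> v < 7 -> E (o + u) (o + v) -> r7_adj u v.
Proof.
move=> oE lt_u lt_v; rewrite /E /nat_backedge /lt /gadget_rank !(arc_R oE) //.
rewrite !ifT; [|by case: oE => ->; lia..].
rewrite !ltn_add2l /r7_adj /arc_of; case: ltngtP => //= _; rewrite ?orbF => -> //.
by rewrite orbT.
Qed.

Lemma R_triangle_free u v x : u < 14 -> v < 14 -> x < 14 ->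
  upper u = upper v -> upper v = upper x -> E u v -> E u x -> E v x -> False.
Proof.
rewrite /upper => u14 v14 x14; rewrite u14 v14 x14 => uv vx.
pose o := if 7 <= x then 7 else 0; have oE : o = 0 \/ o = 7 by rewrite /o; case: ifP; auto.
have shiftE y : (7 <= y) = (7 <= x) -> y < 14 -> y - o < 7 /\ o + (y - o) = y.
  by rewrite /o; case: (7 <= x); lia.
have [lt_u <-] := shiftE u (etrans uv vx) u14; have [lt_v <-] := shiftE v vx v14.
have [lt_x <-] := shiftE x erefl x14.
move=> /(edge_R oE lt_u lt_v) + /(edge_R oE lt_u lt_x) + /(edge_R oE lt_v lt_x).
exact: r7_triangle_free.
Qed.

Lemma coloring_good_order : good_order n A lt.
Proof.
apply/andP; split.
  apply/strict_order_belowP; split=> [u _|u v lt_u lt_v|u v x _ _ _].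
  - by rewrite /lt ltnn.
  - by apply: contraR; rewrite negb_or -!leqNgt -eqn_leq => /eqP/gadget_rank_inj->.
  - exact: ltn_trans.
apply/K4_free_belowP => -[|u [|v [|x [|y [|z s]]]]] // _ /and5P[lt_u lt_v lt_x lt_y _].
apply/negP; rewrite /= -!/(E _ _) !andbT => /and3P[/and3P[uv ux uy] /andP[vx vy] xy].
have := (edge_upper lt_u lt_v uv, edge_upper lt_u lt_x ux, edge_upper lt_u lt_y uy,
  edge_upper lt_v lt_x vx, edge_upper lt_v lt_y vy, edge_upper lt_x lt_y xy).
have triangle z1 z2 z3 : E z1 z2 -> E z1 z3 -> E z2 z3 ->
    [&& z1 < 14, z2 < 14, z3 < 14, upper z1 == upper z2 & upper z2 == upper z3] = false.
  move=> e12 e13 e23; apply/negP => /and5P[lt1 lt2 lt3 /eqP up12 /eqP up23].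
  exact: R_triangle_free up12 up23 e12 e13 e23.
move: (triangle u v x uv ux vx) (triangle u v y uv uy vy) (triangle u x y ux uy xy)
  (triangle v x y vx vy xy).
by case: (u < 14); case: (v < 14); case: (x < 14); case: (y < 14);
  case: (upper u); case: (upper v); case: (upper x); case: (upper y) => //= _ _ _ _ [[[[[]]]]].
Qed.

End FromColoring.

Theorem gadget_three_diomega :
  three_diomega_ordering (matrix_word n A) <-> exists c, acyclic_coloring nV (arc_of bkV) c.
Proof.
rewrite three_diomega_matrix; last exact: arc_of_tournament.
split=> [[lt lt_good]|[c acyclic]]; first by exists (low lt); apply: low_acyclic.
by eexists; apply: coloring_good_order acyclic.
Qed.

End Gadget.

(** * From satisfiability to not-all-equal satisfiability *)

Lemma divn_radix a b x : x < b -> (a * b + x) %/ b = a.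
Proof. by move=> lt_xb; rewrite divnMDl ?divn_small ?addn0 //; lia. Qed.

Lemma modn_radix a b x : x < b -> (a * b + x) %% b = x.
Proof. by move=> lt_xb; rewrite modnMDl modn_small. Qed.

Lemma ltn_radix a b c d : a < b -> c < d -> a * d + c < b * d.
Proof. by nia. Qed.

(* In an instance, literal [i < 3] of clause [j] is the variable [var j i] with sign
   [sgn j i]. *)
Definition lit_true (sgn : nat -> nat -> bool) (var : nat -> nat -> nat) (al : nat -> bool)
    (j i : nat) : bool :=
  al (var j i) == sgn j i.

Definition satisfiable (nclause : nat) sgn var :=
  exists al, forall j, j < nclause -> exists2 i, i < 3 & lit_true sgn var al j i.

Definition nae_satisfiable (nclause : nat) sgn var :=
  exists al, forall j, j < nclause ->
    ~ (lit_true sgn var al j 0 = lit_true sgn var al j 1 /\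
       lit_true sgn var al j 1 = lit_true sgn var al j 2).

Section NaeOfSat.
Variables (nvar nclause : nat) (sgn : nat -> nat -> bool) (var : nat -> nat -> nat).
Hypothesis var_lt : forall j i, j < nclause -> i < 3 -> var j i < nvar.

(* Clause [j] becomes the constraint [2 * j] on its first two literals and [z_j], and the
   constraint [2 * j + 1] on the negation of [z_j], its third literal and the constant
   [F]; here [z_j] is the variable [nvar + j] and [F] is the variable [nvar + nclause]. *)
Definition nae_nvar := nvar + nclause + 1.

Definition nae_sign (k i : nat) : bool :=
  let j := k %/ 2 in
  if k %% 2 == 0 then
    if i == 0 then sgn j 0 else if i == 1 then sgn j 1 else true
  else if i == 0 then false else if i == 1 then sgn j 2 else true.

Definition nae_var (k i : nat) : nat :=
  let j := k %/ 2 in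
  if k %% 2 == 0 then
    if i == 0 then var j 0 else if i == 1 then var j 1 else nvar + j
  else if i == 0 then nvar + j else if i == 1 then var j 2 else nvar + nclause.

Lemma nae_var_lt k i : k < nclause * 2 -> nae_var k i < nae_nvar.
Proof.
move=> lt_k; have lt_j : k %/ 2 < nclause by rewrite ltn_divLR.
have := var_lt lt_j (isT : 0 < 3); have := var_lt lt_j (isT : 1 < 3).
have := var_lt lt_j (isT : 2 < 3).
by rewrite /nae_var /nae_nvar; repeat case: ifP => _; lia.
Qed.

Lemma nae_lit_even al j (lit := lit_true nae_sign nae_var al (j * 2)) :
  [/\ lit 0 = lit_true sgn var al j 0, lit 1 = lit_true sgn var al j 1 & lit 2 = al (nvar + j)].
Proof.
by rewrite /lit /lit_true /nae_sign /nae_var -[j * 2]addn0 divn_radix // modn_radix.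
Qed.

Lemma nae_lit_odd al j (lit := lit_true nae_sign nae_var al (j * 2 + 1)) :
  [/\ lit 0 = ~~ al (nvar + j), lit 1 = lit_true sgn var al j 2
    & lit 2 = al (nvar + nclause)].
Proof.
by rewrite /lit /lit_true /nae_sign /nae_var divn_radix // modn_radix.
Qed.

Lemma nae_satisfiableE :
  nae_satisfiable (nclause * 2) nae_sign nae_var <-> satisfiable nclause sgn var.
Proof.
split=> [[al alP]|[al alP]].
  exists (fun x => al x (+) al (nvar + nclause)) => j lt_j.
  have := alP (j * 2) ltac:(lia); have := alP (j * 2 + 1) ltac:(lia).
  have [-> -> ->] := nae_lit_even al j; have [-> -> ->] := nae_lit_odd al j.
  set F := al (nvar + nclause) => odd even.
  have flip i : lit_true sgn var (fun x => al x (+) F) j i = lit_true sgn var al j i (+) F.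
    by rewrite /lit_true; case: (al _); case: (sgn j i); case: F {odd}.
  have : [|| lit_true sgn var al j 0 (+) F, lit_true sgn var al j 1 (+) F
           | lit_true sgn var al j 2 (+) F].
    move: odd even; case: (lit_true _ _ _ _ 0); case: (lit_true _ _ _ _ 1);
      case: (lit_true _ _ _ _ 2); case: (al (nvar + j)); case: F {flip} => //= odd even;
      by [case: odd | case: even].
  by case/or3P=> lit_i; [exists 0 | exists 1 | exists 2] => //; rewrite flip.
pose al' x := if x < nvar then al x else if x < nvar + nclause
  then ~~ (lit_true sgn var al (x - nvar) 0 || lit_true sgn var al (x - nvar) 1) else false.
exists al' => k lt_k; have lt_j : k %/ 2 < nclause by rewrite ltn_divLR.
have litE i : i < 3 -> lit_true sgn var al' (k %/ 2) i = lit_true sgn var al (k %/ 2) i.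
  by move=> lt_i; rewrite /lit_true /al' var_lt.
have zE : al' (nvar + k %/ 2) =
    ~~ (lit_true sgn var al (k %/ 2) 0 || lit_true sgn var al (k %/ 2) 1).
  by rewrite /al' ltnNge leq_addr ltn_add2l lt_j addKn.
have FE : al' (nvar + nclause) = false by rewrite /al' ltnNge leq_addr ltnn.
have [i lt_i lit_i] := alP _ lt_j.
move: (divn_eq k 2) (ltn_pmod k (isT : 0 < 2)); case: (k %% 2) => [|[|//]] kE _; rewrite kE.
  rewrite addn0; have [-> -> ->] := nae_lit_even al' (k %/ 2); rewrite !litE // zE.
  by case: lit_true; case: lit_true => -[].
have [-> -> ->] := nae_lit_odd al' (k %/ 2); rewrite litE // zE FE.
case: i lt_i lit_i => [|[|[|//]]] _ ->; rewrite ?orbT //=; last by case.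
- by case: lit_true => -[].
- by case: (lit_true _ _ _ _ 2) => -[].
Qed.

End NaeOfSat.

(** * From not-all-equal satisfiability to acyclic 2-colourings *)

Section NaeTournament.
Variables (nvar nclause : nat) (sgn : nat -> nat -> bool) (var : nat -> nat -> nat).

(* In increasing order: the positive literals, a 3-cycle, the negative literals,
   a 3-cycle, and one 3-cycle of literal occurrences per clause. *)
Definition first_occ := 2 * nvar + 6.
Definition nae_size := first_occ + nclause * 3.
Definition clause_of (v : nat) := (v - first_occ) %/ 3.
Definition place_of (v : nat) := (v - first_occ) %% 3.

Definition nae_back (u v : nat) : bool :=
  if v < nvar then false
  else if v < nvar + 3 then (u == nvar) && (v == nvar + 2)
  else if v < 2 * nvar + 3 then v == u + (nvar + 3)
  else if v < first_occ then (u == 2 * nvar + 3) && (v == 2 * nvar + 5)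
  else
    let s := sgn (clause_of v) (place_of v) in
    let x := var (clause_of v) (place_of v) in
    if u < nvar then s && (x == u)
    else if u < nvar + 3 then false
    else if u < 2 * nvar + 3 then ~~ s && (x == u - (nvar + 3))
    else (v == u + 2) && (place_of v == 2).

Hypothesis var_lt : forall j i, j < nclause -> i < 3 -> var j i < nvar.

Definition occ (j i : nat) := first_occ + (j * 3 + i).

Lemma clause_of_occ j i : i < 3 -> clause_of (occ j i) = j.
Proof. by move=> lt_i; rewrite /clause_of /occ addKn divn_radix. Qed.

Lemma place_of_occ j i : i < 3 -> place_of (occ j i) = i.
Proof. by move=> lt_i; rewrite /place_of /occ addKn modn_radix. Qed.

Lemma occP v : first_occ <= v -> v < nae_size ->
  exists j i, [/\ j < nclause, i < 3 & v = occ j i].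
Proof.
move=> le_v lt_v; exists (clause_of v), (place_of v).
rewrite /clause_of /place_of /occ ltn_mod ltn_divLR // -divn_eq subnKC //; split=> //.
by move: lt_v; rewrite /nae_size; lia.
Qed.

Lemma occ_lt j i : j < nclause -> i < 3 -> occ j i < nae_size.
Proof. by rewrite /occ /nae_size; lia. Qed.

Lemma occ_ltF j i b : b <= first_occ -> (occ j i < b) = false.
Proof. by rewrite /occ; lia. Qed.

Lemma nae_back_occ u j i : i < 3 -> nae_back u (occ j i) =
  if u < nvar then sgn j i && (var j i == u)
  else if u < nvar + 3 then false
  else if u < 2 * nvar + 3 then ~~ sgn j i && (var j i == u - (nvar + 3))
  else (occ j i == u + 2) && (i == 2).
Proof.
move=> lt_i; rewrite /nae_back clause_of_occ // place_of_occ //.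
by rewrite !occ_ltF // /first_occ; lia.
Qed.

Section FromColoring.
Variable c : nat -> bool.
Notation arc := (arc_of nae_back).
Hypothesis acyclic : acyclic_coloring nae_size arc c.

Lemma arc_forward u v : u < v -> nae_back u v = false -> arc u v.
Proof. by move=> lt_uv back; rewrite /arc_of lt_uv back. Qed.

Lemma arc_backward u v : u < v -> nae_back u v -> arc v u.
Proof. by move=> lt_uv back; rewrite /arc_of lt_uv ltnNge (ltnW lt_uv). Qed.

Definition cycle_at (b : nat) :=
  [/\ b + 2 < nae_size, nae_back b (b + 1) = false,
      nae_back (b + 1) (b + 2) = false & nae_back b (b + 2)].

Lemma cycle_colors b : cycle_at b -> ~ (c b = c (b + 1) /\ c (b + 1) = c (b + 2)).
Proof.
case=> lt_b b01 b12 b02; apply: acyclic; try lia.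
- by apply: arc_forward => //; lia.
- by apply: arc_forward => //; lia.
- by apply: arc_backward => //; lia.
Qed.

(* A vertex of the 3-cycle with the common colour would close a monochromatic
   triangle, so the 3-cycle would be monochromatic. *)
Lemma back_over_cycle x y b : cycle_at b -> x < b -> b + 2 < y -> y < nae_size ->
  (forall s, b <= s < b + 3 -> nae_back x s = false /\ nae_back s y = false) ->
  nae_back x y -> c y = ~~ c x.
Proof.
move=> cycle_b lt_xb lt_by lt_y none xy; case eq_c: (c x == c y); last first.
  by move: eq_c; case: (c x); case: (c y).
have [lt_b _ _ _] := cycle_b.
have avoid s : b <= s < b + 3 -> c s = ~~ c x.
  move=> sb; have [xs sy] := none s sb.
  suff : c s <> c x by case: (c s); case: (c x).
  move=> cs; apply: (acyclic (x := x) (y := s) (z := y)); rewrite ?cs ?(eqP eq_c) //; try lia.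
  - by apply: arc_forward => //; lia.
  - by apply: arc_forward => //; lia.
  - by apply: arc_backward => //; lia.
by case: (cycle_colors cycle_b); rewrite (avoid b) ?(avoid (b + 1)) ?(avoid (b + 2)); lia.
Qed.

Lemma cycle_at_fst : cycle_at nvar.
Proof. by split; rewrite /nae_size /nae_back /first_occ; repeat (case: ifP => ?); lia. Qed.

Lemma cycle_at_snd : cycle_at (2 * nvar + 3).
Proof. by split; rewrite /nae_size /nae_back /first_occ; repeat (case: ifP => ?); lia. Qed.

Lemma occD j i k : occ j i + k = occ j (i + k).
Proof. by rewrite /occ !addnA. Qed.

Lemma cycle_at_occ j : j < nclause -> cycle_at (occ j 0).
Proof.
move=> lt_j; split; rewrite !occD !add0n; first exact: occ_lt.
all: by rewrite nae_back_occ // /occ /first_occ; repeat (case: ifP => ?); lia.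
Qed.

Lemma color_neg x : x < nvar -> c (nvar + 3 + x) = ~~ c x.
Proof.
move=> lt_x; apply: (back_over_cycle cycle_at_fst); rewrite /nae_size /first_occ; try lia.
  by move=> s sb; rewrite /nae_back /first_occ; split; repeat (case: ifP => ?); lia.
by rewrite /nae_back; repeat (case: ifP => ?); lia.
Qed.

Lemma color_occ j i : j < nclause -> i < 3 -> c (occ j i) = ~~ lit_true sgn var c j i.
Proof.
move=> lt_j lt_i; have lt_var := var_lt lt_j lt_i.
have over x : x < 2 * nvar + 3 -> nae_back x (occ j i) ->
    (forall s, 2 * nvar + 3 <= s < 2 * nvar + 3 + 3 -> nae_back x s = false) ->
    c (occ j i) = ~~ c x.
  move=> lt_x xo none; apply: (back_over_cycle cycle_at_snd) => //; last 1 first.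
  - move=> s sb; rewrite none // nae_back_occ // !ifF; try lia.
    by rewrite /occ /first_occ; lia.
  - by rewrite /occ /first_occ; lia.
  - exact: occ_lt.
have none x s : x < 2 * nvar + 3 -> 2 * nvar + 3 <= s < 2 * nvar + 3 + 3 ->
    nae_back x s = false.
  by move=> lt_x sb; rewrite /nae_back /first_occ; repeat (case: ifP => ?); lia.
rewrite /lit_true; case s: (sgn j i).
  rewrite (over (var j i)); [by case: (c _) | lia | by rewrite nae_back_occ // lt_var s eqxx |].
  by move=> *; apply: none; lia.
rewrite (over (nvar + 3 + var j i)) ?color_neg //; [by case: (c _) | lia | |].
  by rewrite nae_back_occ // s addKn eqxx; repeat (case: ifP => ?); lia.
by move=> *; apply: none; lia.
Qed.

Lemma coloring_nae_satisfiable : nae_satisfiable nclause sgn var.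
Proof.
exists c => j lt_j; have := cycle_colors (cycle_at_occ lt_j).
rewrite !occD !add0n !color_occ // => not_mono [e01 e12]; apply: not_mono.
by rewrite e01 e12.
Qed.

End FromColoring.

Section FromAssignment.
Variable al : nat -> bool.
Hypothesis al_nae : forall j, j < nclause ->
  ~ (lit_true sgn var al j 0 = lit_true sgn var al j 1 /\
     lit_true sgn var al j 1 = lit_true sgn var al j 2).

Definition nae_color (u : nat) : bool :=
  if u < nvar then al u
  else if u < nvar + 3 then u != nvar + 2
  else if u < 2 * nvar + 3 then ~~ al (u - (nvar + 3))
  else if u < first_occ then u != 2 * nvar + 5
  else ~~ lit_true sgn var al (clause_of u) (place_of u).

Lemma nae_color_occ j i : i < 3 -> nae_color (occ j i) = ~~ lit_true sgn var al j i.
Proof.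
move=> lt_i; rewrite /nae_color clause_of_occ // place_of_occ //.
by rewrite !occ_ltF // /first_occ; lia.
Qed.

Lemma mono_back u v : u < v -> v < nae_size -> nae_back u v ->
  nae_color u = nae_color v ->
  exists2 j, j < nclause & u = occ j 0 /\ v = occ j 2.
Proof.
move=> lt_uv lt_v; case: (ltnP v first_occ) => [lt_vo|le_ov].
  rewrite /nae_back lt_vo; case: ifP => // v1; case: ifP => v2.
    case/andP=> /eqP-> /eqP-> eq_c; exfalso; move: eq_c.
    by rewrite /nae_color; repeat (case: ifP => ?); lia.
  case: ifP => v3.
    move=> /eqP vE; rewrite /nae_color v1 v2 v3 vE addnK.
    have -> : u < nvar by lia.
    by case: (al u).
  case/andP=> /eqP-> /eqP-> eq_c; exfalso; move: eq_c.
  by rewrite /nae_color /first_occ; repeat (case: ifP => ?); lia.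
have [j [i [lt_j lt_i ->]]] := occP le_ov lt_v.
rewrite nae_back_occ // nae_color_occ // /lit_true /nae_color.
case: ifP => u1; first by case/andP=> -> /eqP->; case: (al u).
case: ifP => // u2; case: ifP => u3.
  by case/andP=> /negbTE-> /eqP->; case: (al _).
case/andP=> /eqP uE /eqP iE _; exists j => //; rewrite iE in uE *; split=> //.
by move: uE; rewrite /occ; lia.
Qed.

Lemma nae_color_acyclic : acyclic_coloring nae_size (arc_of nae_back) nae_color.
Proof.
have arcP u v : arc_of nae_back u v -> u <> v by move=> + uv; rewrite uv (negbTE (arc_of_irr _ _)).
move=> x y z; wlog [lt_xy lt_xz] : x y z / x < y /\ x < z.
  move=> wlog_min lt_x lt_y lt_z xy yz zx [cxy cyz].
  have neq_xy := arcP _ _ xy; have neq_yz := arcP _ _ yz; have neq_zx := arcP _ _ zx.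
  have [min_x|[min_y|min_z]] : x < y /\ x < z \/ y < z /\ y < x \/ z < x /\ z < y by lia.
  - exact: (wlog_min x y z).
  - by apply: (wlog_min y z x) => //; rewrite cyz cxy.
  - by apply: (wlog_min z x y) => //; rewrite cxy cyz.
move=> _ lt_y lt_z _ yz zx [cxy cyz].
have xz : nae_back x z by move: zx; rewrite /arc_of ltnNge (ltnW lt_xz) lt_xz.
have [j lt_j [xE zE]] := mono_back lt_xz lt_z xz (etrans cxy cyz).
case: (ltngtP y z) => [lt_yz|lt_zy|eq_yz]; last by case: (arcP _ _ yz).
  have yE : y = occ j 1 by move: lt_xy lt_yz; rewrite xE zE /occ; lia.
  apply: (al_nae lt_j); move: cxy cyz; rewrite xE yE zE !nae_color_occ //.
  by move=> /negb_inj-> /negb_inj->.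
have zy : nae_back z y by move: yz; rewrite /arc_of ltnNge (ltnW lt_zy) lt_zy.
have [j' _ [zE' _]] := mono_back lt_zy lt_y zy (esym cyz).
by move: zE'; rewrite zE /occ; lia.
Qed.

End FromAssignment.

Theorem nae_acyclic_coloring :
  (exists c, acyclic_coloring nae_size (arc_of nae_back) c) <->
  nae_satisfiable nclause sgn var.
Proof.
split=> [[c]|[al al_nae]]; first exact: coloring_nae_satisfiable.
by exists (nae_color al); apply: nae_color_acyclic.
Qed.

End NaeTournament.

(** * Tableaux of nondeterministic machines *)

Section TapeCells.
Variable G : finType.
Implicit Type t : tape G.

(* The symbol in cell [x], when the head is on cell [p]. *)
Definition cell t (p x : nat) : tsymbol G :=
  if x < p then nth None (tleft t) (p - x.+1)
  else if x == p then thead t else nth None (tright t) (x - p.+1).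

Lemma cell_head t p : cell t p p = thead t.
Proof. by rewrite /cell ltnn eqxx. Qed.

Lemma cell_act t p x a : 0 < p ->
  cell (tape_act t a) (shift a.2 p) x = if x == p then a.1 else cell t p x.
Proof.
case: t a => l h r [s m] p_gt0; rewrite /cell /tape_act /=; case: m => /=.
- case: (ltngtP x p) => [lt_xp|lt_px|->].
  + case: (ltngtP x p.-1) => [lt_xp1|gt_xp1|->]; last 1 first.
    * by rewrite prednK // subnn nth0.
    * by rewrite nth_behead; congr nth; lia.
    * by lia.
  + have [-> ->] : (x < p.-1) = false /\ (x == p.-1) = false by lia.
    by have -> : x - p.-1.+1 = (x - p.+1).+1 by lia.
  + have [-> ->] : (p < p.-1) = false /\ (p == p.-1) = false by lia.
    by rewrite prednK // subnn.
- by case: (ltngtP x p).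
- case: (ltngtP x p) => [lt_xp|lt_px|->].
  + by rewrite ltnS (ltnW lt_xp); have -> : p.+1 - x.+1 = (p - x.+1).+1 by lia.
  + rewrite ltnNge lt_px /=; case: (eqVneq x p.+1) => [->|neq]; first by rewrite subnn nth0.
    by rewrite nth_behead; congr nth; lia.
  + by rewrite ltnSn subSS subnn.
Qed.

Lemma cell_input w p x : cell (input_tape G w) p x =
  if (p <= x) && (x < p + size w) then Some (inl (nth false w (x - p))) else None.
Proof.
have nthE k : nth None (word_symbols G w) k =
    if k < size w then Some (inl (nth false w k)) else None.
  case: ltnP => ?; first by rewrite (nth_map false).
  by rewrite nth_default // size_map.
rewrite /cell /input_tape /=; case: (ltngtP x p) => [lt_xp|lt_px|->] /=.
- by rewrite nth_nil.
- rewrite nth_behead nthE; have -> : (x - p.+1).+1 = x - p by lia.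
  by rewrite ltn_subLR // ltnW.
- by rewrite -nth0 nthE subnn -[X in X < _ + _]addn0 ltn_add2l.
Qed.

Lemma tape_act_stay t : tape_act t (thead t, Stay) = t.
Proof. by case: t. Qed.

End TapeCells.

(* A clause of the tableau refers to two cells [x] and [y]. *)
Inductive position := PosZero | PosX | PosY | PosRight | PosLeft.

Definition pos_cell (s : position) (x y : nat) : nat :=
  match s with
  | PosZero => 0 | PosX => x | PosY => y | PosRight => x.+1 | PosLeft => x.-1
  end.

Definition move_pos (m : move) : position :=
  match m with MoveL => PosLeft | Stay => PosX | MoveR => PosRight end.

Inductive guard :=
| Always | Never | Distinct | Initially | InitialHead | InputBlank | InputBit of bool.

Definition guard_holds (w : seq bool) (T : nat) (h : guard) (t x y : nat) : bool :=
  match h with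
  | Always => true
  | Never => false
  | Distinct => ~~ (x == y)
  | Initially => t == 0
  | InitialHead => (t == 0) && (x == T)
  | InputBlank => (t == 0) && ~~ ((T <= x) && (x < T + size w))
  | InputBit b => (t == 0) && ((T <= x) && (x < T + size w) && (nth false w (x - T) == b))
  end.

Inductive family :=
| StartState | StartHead | StartCell | AmongNone | AmongAll | AmongStep
| Allowed | Source | Scanned | Target | Moved | Written | Frame.

Definition family_code (f : family) : 'I_13 :=
  match f with
  | StartState => @Ordinal 13 0 isT | StartHead => @Ordinal 13 1 isT
  | StartCell => @Ordinal 13 2 isT | AmongNone => @Ordinal 13 3 isT
  | AmongAll => @Ordinal 13 4 isT | AmongStep => @Ordinal 13 5 isT
  | Allowed => @Ordinal 13 6 isT | Source => @Ordinal 13 7 isT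
  | Scanned => @Ordinal 13 8 isT | Target => @Ordinal 13 9 isT
  | Moved => @Ordinal 13 10 isT | Written => @Ordinal 13 11 isT
  | Frame => @Ordinal 13 12 isT
  end.
Definition family_decode (i : 'I_13) : family :=
  nth StartState [:: StartState; StartHead; StartCell; AmongNone; AmongAll; AmongStep;
    Allowed; Source; Scanned; Target; Moved; Written; Frame] i.
Lemma family_codeK : cancel family_code family_decode.
Proof. by case. Qed.
HB.instance Definition _ := Finite.copy family (can_type family_codeK).

Section CookLevin.
Variable M : tm.
Notation Q := (tm_state M).
Notation I := 'I_(tm_k M).+1.
Notation Sy := (tsymbol (tm_work M)).

Definition transition : finType :=
  (Q * {ffun I -> Sy} * Q * {ffun I -> Sy * move})%type.
Definition tr_src (d : transition) := d.1.1.1.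
Definition tr_scan (d : transition) := d.1.1.2.
Definition tr_dst (d : transition) := d.1.2.
Definition tr_act (d : transition) := d.2.

(* Accepting halted configurations are allowed to loop. *)
Definition stutter (d : transition) : bool :=
  [&& tm_accept (tr_src d),
      [forall q, forall a, ~~ tm_delta (tr_src d) (tr_scan d) q a],
      tr_dst d == tr_src d & tr_act d == [ffun i => (tr_scan d i, Stay)]].
Definition allowed (d : transition) : bool :=
  tm_delta (tr_src d) (tr_scan d) (tr_dst d) (tr_act d) || stutter d.

(* The propositional variables at a time and a cell. [Among j] states that the transition
   taken is one of the first [j], so that the disjunction of all [Taken d] is spread over
   clauses of three literals. *)
Inductive fact :=
| State of Q
| Head of I
| Cell of I & Sy
| Taken of transition
| Among of 'I_(#|transition|).+1.

Definition fact_code (k : fact) : Q + I + (I * Sy) + transition + 'I_(#|transition|).+1 :=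
  match k with
  | State q => inl (inl (inl (inl q)))
  | Head i => inl (inl (inl (inr i)))
  | Cell i a => inl (inl (inr (i, a)))
  | Taken d => inl (inr d)
  | Among j => inr j
  end.
Definition fact_decode (s : Q + I + (I * Sy) + transition + 'I_(#|transition|).+1) : fact :=
  match s with
  | inl (inl (inl (inl q))) => State q
  | inl (inl (inl (inr i))) => Head i
  | inl (inl (inr (i, a))) => Cell i a
  | inl (inr d) => Taken d
  | inr j => Among j
  end.
Lemma fact_codeK : cancel fact_code fact_decode.
Proof. by case. Qed.
HB.instance Definition _ := Finite.copy fact (can_type fact_codeK).

Record literal := Literal {
  lit_sign : bool; lit_fact : fact; lit_next : bool; lit_pos : position
}.

Definition now (k : fact) (s : position) := Literal true k false s.
Definition not_now (k : fact) (s : position) := Literal false k false s.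
Definition next (k : fact) (s : position) := Literal true k true s.

Record clause := Clause { clause_guard : guard; clause_lit : nat -> literal }.

Definition clause3 (h : guard) (l0 l1 l2 : literal) := Clause h (nth l2 [:: l0; l1]).
Definition clause1 (h : guard) (l : literal) := clause3 h l l l.

Definition before_rank (d : transition) : 'I_(#|transition|).+1 :=
  widen_ord (leqnSn _) (enum_rank d).
Definition upto_rank (d : transition) : 'I_(#|transition|).+1 := lift ord0 (enum_rank d).

Definition start_guard (i : I) (a : Sy) : guard :=
  match a with
  | None => if i == ord0 then InputBlank else Initially
  | Some (inl b) => if i == ord0 then InputBit b else Never
  | Some (inr _) => Never
  end.

Definition family_clause (f : family) (d : transition) (i : I) (a : Sy) (q : Q) : clause :=
  match f with
  | StartState => clause1 Initially (now (State (tm_start M)) PosZero)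
  | StartHead => clause1 InitialHead (now (Head i) PosX)
  | StartCell => clause1 (start_guard i a) (now (Cell i a) PosX)
  | AmongNone => clause1 Always (not_now (Among ord0) PosZero)
  | AmongAll => clause1 Always (now (Among ord_max) PosZero)
  | AmongStep => clause3 Always (not_now (Among (upto_rank d)) PosZero)
      (now (Among (before_rank d)) PosZero) (now (Taken d) PosZero)
  | Allowed => clause1 (if allowed d then Never else Always) (not_now (Taken d) PosZero)
  | Source => clause3 (if q == tr_src d then Never else Always)
      (not_now (Taken d) PosZero) (not_now (Taken d) PosZero) (not_now (State q) PosZero)
  | Scanned => clause3 (if a == tr_scan d i then Never else Always)
      (not_now (Taken d) PosZero) (not_now (Head i) PosX) (not_now (Cell i a) PosX)
  | Target => clause3 Always (not_now (Taken d) PosZero) (not_now (Taken d) PosZero)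
      (next (State (tr_dst d)) PosZero)
  | Moved => clause3 Always (not_now (Taken d) PosZero) (not_now (Head i) PosX)
      (next (Head i) (move_pos (tr_act d i).2))
  | Written => clause3 Always (not_now (Taken d) PosZero) (not_now (Head i) PosX)
      (next (Cell i (tr_act d i).1) PosX)
  | Frame => clause3 Distinct (not_now (Head i) PosX) (not_now (Cell i a) PosY)
      (next (Cell i a) PosY)
  end.

Implicit Types (be : fact -> nat -> nat -> bool).

Definition literal_true be (t x y : nat) (l : literal) : bool :=
  let v := be (lit_fact l) (if lit_next l then t.+1 else t) (pos_cell (lit_pos l) x y) in
  if lit_sign l then v else ~~ v.

Definition clause_true be (t x y : nat) (c : clause) : bool :=
  [|| literal_true be t x y (clause_lit c 0), literal_true be t x y (clause_lit c 1)
    | literal_true be t x y (clause_lit c 2)].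

Section Tableau.
Variables (w : seq bool) (T : nat).
Notation X := (2 * T + 1).

Definition tableau be := forall f d i a q t x y, t < T -> x < X -> y < X ->
  let c := family_clause f d i a q in
  guard_holds w T (clause_guard c) t x y -> clause_true be t x y c.

Definition input_of (i : I) : seq bool := if i == ord0 then w else [::].

Lemma start_guardP i a t x y : guard_holds w T (start_guard i a) t x y =
  (t == 0) && (cell (input_tape (tm_work M) (input_of i)) T x == a).
Proof.
rewrite cell_input /input_of; case: a => [[b|b]|] /=; case: eqP => _ //=;
  rewrite ?addn0; case: (t == 0) => //=.
- by case: ifP.
- by rewrite ltnNge andbN.
- by case: ifP.
- by case: ifP.
- by case: ifP.
- by rewrite ltnNge andbN.
Qed.

Definition config_true be t (c : config M) :=
  be (State (cstate c)) t 0 /\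
  forall i, exists p, [/\ T - t <= p <= T + t, be (Head i) t p &
    forall x, x < X -> be (Cell i (cell (ctapes c i) p x)) t x].

Section TableauFacts.
Variable be : fact -> nat -> nat -> bool.
Hypothesis tab : tableau be.

Let any_transition : transition :=
  (tm_start M, [ffun=> None], tm_start M, [ffun=> (None, Stay)]).

Lemma tableau_start : 0 < T -> config_true be 0 (init_config M w).
Proof.
move=> T_gt0; split=> [|i].
  have := @tab StartState any_transition ord0 None (tm_start M) 0 0 0 T_gt0.
  by rewrite /clause_true /literal_true /= !orbb; apply; lia.
exists T; split=> [||x lt_x]; first by rewrite subn0 addn0 leqnn.
  have := @tab StartHead any_transition i None (tm_start M) 0 T T T_gt0.
  by rewrite /clause_true /literal_true /= eqxx !orbb; apply; lia.
rewrite /= ffunE; set a := cell _ T x.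
have := @tab StartCell any_transition i a (tm_start M) 0 x x T_gt0 lt_x lt_x.
by rewrite /= start_guardP eqxx /clause_true /literal_true /= !orbb; apply.
Qed.

Variable t : nat.
Hypothesis lt_tT : t < T.

Let X_gt0 : 0 < X. Proof. by rewrite addn1. Qed.

Lemma tableau_taken : exists d, be (Taken d) t 0.
Proof.
have none : be (Among ord0) t 0 = false.
  have := @tab AmongNone any_transition ord0 None (tm_start M) t 0 0 lt_tT X_gt0 X_gt0 isT.
  by rewrite /clause_true /literal_true /= !orbb => /negbTE.
have all_of_them : be (Among ord_max) t 0.
  have := @tab AmongAll any_transition ord0 None (tm_start M) t 0 0 lt_tT X_gt0 X_gt0 isT.
  by rewrite /clause_true /literal_true /= !orbb.
have step d : be (Among (upto_rank d)) t 0 -> be (Among (before_rank d)) t 0 || be (Taken d) t 0.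
  have := @tab AmongStep d ord0 None (tm_start M) t 0 0 lt_tT X_gt0 X_gt0 isT.
  by rewrite /clause_true /literal_true /= => + among; rewrite among.
suff upto k (lt_k : k < #|transition|.+1) :
    be (Among (Ordinal lt_k)) t 0 -> exists d, be (Taken d) t 0.
  by apply: (upto _ (ltnSn _)); rewrite (_ : Ordinal _ = ord_max) //; apply: val_inj.
elim: k lt_k => [|k IH] lt_k.
  by rewrite (_ : Ordinal _ = ord0) ?none //; apply: val_inj.
pose d := enum_val (Ordinal (lt_k : k < #|transition|)).
have dk : enum_rank d = k :> nat by rewrite enum_valK.
rewrite (_ : Ordinal lt_k = upto_rank d); last by apply: val_inj; rewrite /= dk.
case/step/orP=> [among|]; last by exists d.
apply: (IH (ltnW lt_k)); rewrite (_ : Ordinal _ = before_rank d) //.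
by apply: val_inj; rewrite /= dk.
Qed.

Variable d : transition.
Hypothesis taken : be (Taken d) t 0.

Lemma tableau_allowed : allowed d.
Proof.
have := @tab Allowed d ord0 None (tm_start M) t 0 0 lt_tT X_gt0 X_gt0.
by rewrite /clause_true /literal_true /= taken; case: ifP => // _ /(_ isT).
Qed.

Lemma tableau_source q : be (State q) t 0 -> q = tr_src d.
Proof.
have := @tab Source d ord0 None q t 0 0 lt_tT X_gt0 X_gt0.
rewrite /clause_true /literal_true /= taken; case: eqP => // _ /(_ isT) /= + qE.
by rewrite qE.
Qed.

Lemma tableau_scanned i a x : x < X -> be (Head i) t x -> be (Cell i a) t x -> a = tr_scan d i.
Proof.
move=> lt_x; have := @tab Scanned d i a (tm_start M) t x x lt_tT lt_x lt_x.
rewrite /clause_true /literal_true /= taken; case: eqP => // _ /(_ isT) /= + head cellE.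
by rewrite head cellE.
Qed.

Lemma tableau_target : be (State (tr_dst d)) t.+1 0.
Proof.
have := @tab Target d ord0 None (tm_start M) t 0 0 lt_tT X_gt0 X_gt0 isT.
by rewrite /clause_true /literal_true /= taken.
Qed.

Lemma tableau_moved i x : x < X -> be (Head i) t x ->
  be (Head i) t.+1 (shift (tr_act d i).2 x).
Proof.
move=> lt_x head; have := @tab Moved d i None (tm_start M) t x x lt_tT lt_x lt_x isT.
by rewrite /clause_true /literal_true /= taken head; case: (tr_act d i).2.
Qed.

Lemma tableau_written i x : x < X -> be (Head i) t x -> be (Cell i (tr_act d i).1) t.+1 x.
Proof.
move=> lt_x head; have := @tab Written d i None (tm_start M) t x x lt_tT lt_x lt_x isT.
by rewrite /clause_true /literal_true /= taken head.
Qed.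

Lemma tableau_frame i a x y : x < X -> y < X -> x != y ->
  be (Head i) t x -> be (Cell i a) t y -> be (Cell i a) t.+1 y.
Proof.
move=> lt_x lt_y neq_xy head cellE.
have := @tab Frame d i a (tm_start M) t x y lt_tT lt_x lt_y neq_xy.
by rewrite /clause_true /literal_true /= head cellE.
Qed.

End TableauFacts.

Lemma tableau_step be t c : tableau be -> t < T -> config_true be t c ->
  exists2 c', config_true be t.+1 c' &
    step c c' \/ [/\ c' = c, halted c & tm_accept (cstate c)].
Proof.
move=> tab lt_tT [state tapes]; have [d taken] := tableau_taken tab lt_tT.
have src := tableau_source tab lt_tT taken state.
have scan_d : tr_scan d = scanned c.
  apply/ffunP => i; rewrite ffunE; have [p [p_bound head cells]] := tapes i.
  symmetry; apply: (tableau_scanned tab lt_tT taken (i := i) (x := p)) => //; first by lia.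
  by rewrite -(cell_head (ctapes c i) p); apply: cells; lia.
pose c' : config M := @Config M (tr_dst d) [ffun i => tape_act (ctapes c i) (tr_act d i)].
have c'_true : config_true be t.+1 c'.
  split=> [|i]; first exact: (tableau_target tab lt_tT taken).
  have [p [p_bound head cells]] := tapes i; have lt_pX : p < X by lia.
  exists (shift (tr_act d i).2 p); split=> [||x lt_x].
  - by case: (tr_act d i).2 => /=; lia.
  - exact: tableau_moved.
  rewrite /c' /= ffunE cell_act; last by lia.
  case: (eqVneq x p) => [->|neq_xp]; first exact: (tableau_written tab lt_tT taken).
  by apply: (tableau_frame tab lt_tT d (i := i) (x := p)) => //; rewrite 1?eq_sym // cells.
exists c' => //; case/orP: (tableau_allowed tab lt_tT taken) => [delta_d|].
  by left; exists (tr_act d) => //=; rewrite src -scan_d.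
case/and4P=> acc /forallP no_step /eqP dst /eqP actE; right; split.
- rewrite /c' dst -src; case: (c) scan_d => q tp scan_d; congr Config.
  by apply/ffunP => i; rewrite !ffunE actE ffunE scan_d ffunE tape_act_stay.
- move=> e [a /=]; rewrite src -scan_d => delta_e.
  by have /forallP/(_ a) := no_step (cstate e); rewrite delta_e.
- by rewrite src.
Qed.

Lemma tableau_accepts be : (forall n c, nsteps n (init_config M w) c -> n < T) ->
  tableau be -> accepts M w.
Proof.
move=> bound tab; have T_gt0 : 0 < T by apply: (bound 0 (init_config M w)).
suff reach t : t <= T -> exists2 c, config_true be t c &
    exists2 k, nsteps k (init_config M w) c & k = t \/ halted c /\ tm_accept (cstate c).
  have [c _ [k run [kT|[hc acc]]]] := reach T (leqnn T); last by exists k, c.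
  by have := bound _ _ run; rewrite kT ltnn.
elim: t => [|t IH] lt_t.
  exists (init_config M w); first exact: tableau_start.
  by exists 0 => //; left.
have [c c_true [k run kE]] := IH (ltnW lt_t).
have [c' c'_true next_c] := tableau_step tab lt_t c_true; exists c' => //.
case: next_c => [cc'|[-> hc acc]]; last by exists k => //; right.
case: kE => [kt|[hc _]]; last by case: (hc c').
exists t.+1; last by left.
by rewrite -addn1 -kt; apply: nsteps_trans run _; exists c'.
Qed.

Definition linked (c : config M) (d : transition) (c' : config M) :=
  [/\ tr_src d = cstate c, tr_scan d = scanned c, tr_dst d = cstate c' &
      ctapes c' = [ffun i => tape_act (ctapes c i) (tr_act d i)]].

Lemma accepting_path n c c' : nsteps n c c' -> halted c' -> tm_accept (cstate c') ->
  exists (conf : nat -> config M) (tr : nat -> transition),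
  conf 0 = c /\ forall k, allowed (tr k) /\ linked (conf k) (tr k) (conf k.+1).
Proof.
move=> + hc' acc; elim: n c => [|n IH] c /=.
  move=> ->; pose d : transition :=
    (cstate c', scanned c', cstate c', [ffun i => (scanned c' i, Stay)]).
  exists (fun=> c'), (fun=> d); split=> // _; split.
    apply/orP; right; apply/and4P; split=> //.
    apply/forallP => q; apply/forallP => a; apply/negP => delta.
    by case: (hc' (@Config M q [ffun i => tape_act (ctapes c' i) (a i)])); exists a.
  by split=> //; apply/ffunP => i; rewrite !ffunE tape_act_stay.
case=> e [a delta eE] /IH[conf [tr [conf0 path]]].
exists (fun k => if k is k'.+1 then conf k' else c).
exists (fun k => if k is k'.+1 then tr k' else (cstate c, scanned c, cstate e, a)).
split=> // -[|k] //; split; first by rewrite /allowed /= delta.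
by rewrite conf0.
Qed.

Section Run.
Variables (conf : nat -> config M) (tr : nat -> transition).
Hypothesis conf0 : conf 0 = init_config M w.
Hypothesis path : forall k, allowed (tr k) /\ linked (conf k) (tr k) (conf k.+1).

Fixpoint head_pos (i : I) (t : nat) : nat :=
  if t is t'.+1 then shift (tr_act (tr t') i).2 (head_pos i t') else T.

Lemma head_pos_gt0 i t : t < T -> 0 < head_pos i t.
Proof.
have : T - t <= head_pos i t; last by lia.
by elim: t => [|t] /=; [lia | case: (tr_act (tr t) i).2 => /=; lia].
Qed.

Definition run_fact (k : fact) (t x : nat) : bool :=
  match k with
  | State q => q == cstate (conf t)
  | Head i => x == head_pos i t
  | Cell i a => a == cell (ctapes (conf t) i) (head_pos i t) x
  | Taken d => d == tr t
  | Among j => enum_rank (tr t) < j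
  end.

Lemma run_cellS i t x : t < T -> cell (ctapes (conf t.+1) i) (head_pos i t.+1) x =
  if x == head_pos i t then (tr_act (tr t) i).1 else cell (ctapes (conf t) i) (head_pos i t) x.
Proof.
move=> lt_t; have [_ [_ _ _ ->]] := path t.
by rewrite ffunE /= cell_act // head_pos_gt0.
Qed.

Lemma run_tableau : tableau run_fact.
Proof.
move=> f d i a q t x y lt_t lt_x lt_y /=; have [ok [src scan_t dst _]] := path t.
rewrite /clause_true /literal_true; case: f => /=; rewrite ?orbb.
- by move/eqP->; rewrite conf0.
- by case/andP=> /eqP-> /eqP->.
- by rewrite start_guardP => /andP[/eqP-> /eqP<-]; rewrite conf0 /= ffunE.
- by [].
- by rewrite ltn_ord.
- move=> _; rewrite /bump leq0n add1n ltnS leq_eqVlt.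
  have -> : (enum_rank (tr t) == enum_rank d :> nat) = (d == tr t).
    by rewrite eq_sym (inj_eq val_inj) (inj_eq enum_rank_inj).
  by case: (d == tr t) => //; case: ltnP.
- by case: ifP => // not_ok _; apply: contraFN not_ok => /eqP->.
- case: eqP => //= neq _; case: eqP => //= dE; case: eqP => // qE.
  by case: neq; rewrite dE src.
- case: eqP => //= neq _; case: eqP => //= dE; case: eqP => //= xE; case: eqP => // aE.
  by case: neq; rewrite dE scan_t aE xE ffunE cell_head.
- by move=> _; case: eqP => //= ->; rewrite dst.
- move=> _; case: eqP => //= ->; case: eqP => //= ->.
  by case: (tr_act (tr t) i).2.
- move=> _; case: eqP => //= ->; case: eqP => //= xE.
  by rewrite -/(head_pos i t.+1) run_cellS // xE !eqxx.
- move=> neq_xy; case: eqP => //= xE; case: eqP => //= aE.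
  by rewrite -/(head_pos i t.+1) run_cellS // -xE (eq_sym y) (negbTE neq_xy) aE -xE.
Qed.

End Run.

Lemma accepts_tableau : accepts M w -> exists be, tableau be.
Proof.
move=> [n [c [run hc acc]]]; have [conf [tr [conf0 path]]] := accepting_path run hc acc.
by exists (run_fact conf tr); apply: run_tableau.
Qed.

End Tableau.

End CookLevin.

(** * The reduction *)

Section Coding.
Variable M : tm.
Notation Q := (tm_state M).
Notation I := 'I_(tm_k M).+1.
Notation Sy := (tsymbol (tm_work M)).

Definition template : finType := (family * transition M * I * Sy * Q)%type.

Definition template_clause (p : template) : clause M :=
  let: (f, d, i, a, q) := p in family_clause f d i a q.

Definition default_clause : clause M := clause1 Never (now (State (tm_start M)) PosZero).

Definition nth_clause (k : nat) : clause M :=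
  nth default_clause [seq template_clause p | p <- enum template] k.

Lemma nth_clause_default k : #|template| <= k -> nth_clause k = default_clause.
Proof. by move=> le_k; rewrite /nth_clause nth_default // size_map -cardE. Qed.

Lemma nth_clause_rank p : nth_clause (enum_rank p) = template_clause p.
Proof. by rewrite /nth_clause (nth_map p) ?nth_enum_rank // -cardE. Qed.

Lemma nth_clauseP k : k < #|template| -> exists p, nth_clause k = template_clause p.
Proof.
move=> lt_k; exists (enum_val (Ordinal lt_k)).
by rewrite -nth_clause_rank enum_valK.
Qed.

Variables (w : seq bool) (T : nat).
Hypothesis T_gt0 : 0 < T.
Notation X := (2 * T + 1).

(* A variable is numbered by its fact, time and cell in mixed radix, and a clause of the
   tableau by its template, its time and its two cells. *)
Definition fact_number (f : fact M) (t x : nat) : nat :=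
  (enum_rank f * (T + 1) + t) * (X + 1) + x.

Definition literal_number (l : literal M) (t x y : nat) : nat :=
  fact_number (lit_fact l) (if lit_next l then t.+1 else t) (pos_cell (lit_pos l) x y).

Definition tab_nvar := #|{: fact M}| * (T + 1) * (X + 1).
Definition tab_nclause := #|template| * T * X * X.

Definition clause_y j := j %% X.
Definition clause_x j := j %/ X %% X.
Definition clause_t j := j %/ X %/ X %% T.
Definition clause_k j := j %/ X %/ X %/ T.

Definition clause_active (j : nat) : bool :=
  guard_holds w T (clause_guard (nth_clause (clause_k j)))
    (clause_t j) (clause_x j) (clause_y j).

(* An inactive number denotes the tautology [v \/ ~ v \/ v]. *)
Definition tab_sign (j i : nat) : bool :=
  if clause_active j then lit_sign (clause_lit (nth_clause (clause_k j)) i) else i != 1.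
Definition tab_var (j i : nat) : nat :=
  if clause_active j
  then literal_number (clause_lit (nth_clause (clause_k j)) i)
         (clause_t j) (clause_x j) (clause_y j)
  else 0.

Lemma fact_number_lt f t x : t <= T -> x <= X -> fact_number f t x < tab_nvar.
Proof.
move=> le_t le_x; have lt_f : enum_rank f < #|{: fact M}| by apply: ltn_ord.
by rewrite /tab_nvar !ltn_radix // addn1.
Qed.

Lemma pos_cell_leq s x y : x < X -> y < X -> pos_cell s x y <= X.
Proof. by case: s => /=; lia. Qed.

Lemma literal_number_lt l t x y : t < T -> x < X -> y < X -> literal_number l t x y < tab_nvar.
Proof.
move=> lt_t lt_x lt_y; apply: fact_number_lt; last exact: pos_cell_leq.
by case: lit_next => //; apply: ltnW.
Qed.

Lemma clause_decode j : j < tab_nclause ->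
  [/\ clause_k j < #|template|, clause_t j < T, clause_x j < X & clause_y j < X].
Proof.
move=> lt_j; rewrite /clause_t /clause_x /clause_y !ltn_mod; split=> //; try lia.
by rewrite /clause_k !ltn_divLR //; lia.
Qed.

Lemma clause_encode k t x y : k < #|template| -> t < T -> x < X -> y < X ->
  exists2 j, j < tab_nclause &
    [/\ clause_k j = k, clause_t j = t, clause_x j = x & clause_y j = y].
Proof.
move=> lt_k lt_t lt_x lt_y; exists (((k * T + t) * X + x) * X + y).
  by rewrite /tab_nclause !ltn_radix.
by rewrite /clause_k /clause_t /clause_x /clause_y !divn_radix // !modn_radix.
Qed.

Lemma tab_var_lt j i : j < tab_nclause -> tab_var j i < tab_nvar.
Proof.
case/clause_decode=> lt_k lt_t lt_x lt_y; rewrite /tab_var; case: ifP => _.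
  exact: literal_number_lt.
exact: leq_ltn_trans (leq0n _) (fact_number_lt (State (tm_start M)) (leq0n T) (leq0n X)).
Qed.

Lemma tableau_of_assignment al :
  (forall j, j < tab_nclause -> exists2 i, i < 3 & lit_true tab_sign tab_var al j i) ->
  tableau w T (fun f t x => al (fact_number f t x)).
Proof.
move=> alP f d i a q t x y lt_t lt_x lt_y c active.
pose p : template := (f, d, i, a, q).
have cE : c = nth_clause (enum_rank p) by rewrite nth_clause_rank.
have [j lt_j [kE tE xE yE]] := clause_encode (ltn_ord (enum_rank p)) lt_t lt_x lt_y.
have [m lt_m] := alP j lt_j.
rewrite /lit_true /tab_var /tab_sign /clause_active kE tE xE yE -cE active => /eqP lit_m.
have : literal_true (fun f t x => al (fact_number f t x)) t x y (clause_lit c m).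
  by rewrite /literal_true -/(literal_number _ _ _ _) lit_m; case: lit_sign.
by rewrite /clause_true; case: m lt_m {lit_m} => [|[|[|//]]] _ ->; rewrite ?orbT.
Qed.

Lemma assignment_of_tableau be : tableau (M := M) w T be ->
  satisfiable tab_nclause tab_sign tab_var.
Proof.
move=> tab; pose fact_of n : fact M := nth (State (tm_start M)) (enum {: fact M}) n.
pose al v := be (fact_of (v %/ (X + 1) %/ (T + 1))) (v %/ (X + 1) %% (T + 1)) (v %% (X + 1)).
have alE f t x : t <= T -> x <= X -> al (fact_number f t x) = be f t x.
  move=> le_t le_x; have lt_t : t < T + 1 by rewrite addn1.
  have lt_x : x < X + 1 by rewrite addn1.
  rewrite /al /fact_number (divn_radix _ lt_x) (modn_radix _ lt_x).
  by rewrite (divn_radix _ lt_t) (modn_radix _ lt_t) /fact_of nth_enum_rank.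
exists al => j /clause_decode[lt_k lt_t lt_x lt_y].
rewrite /lit_true /tab_sign /tab_var; case active: (clause_active j); last first.
  by case al0: (al 0); [exists 0 | exists 1].
have litE l : literal_true be (clause_t j) (clause_x j) (clause_y j) l ->
    al (literal_number l (clause_t j) (clause_x j) (clause_y j)) == lit_sign l.
  rewrite /literal_number alE; [| by case: lit_next => //; lia | exact: pos_cell_leq].
  by rewrite /literal_true; case: (lit_sign l) => [->|/negbTE->].
have [[[[[f d] i] a] q] cE] := nth_clauseP lt_k.
have := tab f d i a q _ _ _ lt_t lt_x lt_y; rewrite /clause_active cE /= in active *.
by case/(_ active)/or3P=> /litE lit; [exists 0 | exists 1 | exists 2].
Qed.

Lemma satisfiable_tableau :
  satisfiable tab_nclause tab_sign tab_var <-> exists be, tableau (M := M) w T be.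
Proof.
split=> [[al /tableau_of_assignment tab]|[be]]; last exact: assignment_of_tableau.
by eexists; apply: tab.
Qed.

End Coding.

Lemma definable_guard T h t x y : numeric (fun w _ _ => T w) -> numeric t ->
  numeric x -> numeric y ->
  definable (fun w g e => guard_holds w (T w) h (t w g e) (x w g e) (y w g e)).
Proof. by move=> nT nt nx ny; case: h => [||||||b] /=; numeric. Qed.

Lemma numeric_pos_cell s x y : numeric x -> numeric y ->
  numeric (fun w g e => pos_cell s (x w g e) (y w g e)).
Proof. by move=> nx ny; case: s => /=; numeric. Qed.

Lemma definable_r7_back u v : numeric u -> numeric v ->
  definable (fun w g e => r7_back (u w g e) (v w g e)).
Proof.
move=> nu nv; apply: (@definable_cases 7 (fun k w g e => r7_back k (v w g e))) => //.
  move=> k; apply: (@definable_cases 7 (fun l _ _ _ => r7_back k l)) => // [l|l w g e le_l].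
    exact: definable_const.
  by rewrite /r7_back; move: k l le_l => [|[|[|[|[|[|[|k]]]]]]] l le_l;
    rewrite /= ?nth_nil ?inE //; lia.
by move=> k w g e le_k; rewrite /r7_back !nth_default.
Qed.

Section Reduction.
Variables (M : tm) (T : seq bool -> nat).
Hypothesis nT : numeric (fun w _ _ => T w).

Section Clause.
Variable F : context_fun nat.
Hypothesis nF : numeric F.

Lemma numeric_clause_y : numeric (fun w g e => clause_y (T w) (F w g e)).
Proof. by rewrite /clause_y; numeric. Qed.

Lemma numeric_clause_x : numeric (fun w g e => clause_x (T w) (F w g e)).
Proof. by rewrite /clause_x; numeric. Qed.

Lemma numeric_clause_t : numeric (fun w g e => clause_t (T w) (F w g e)).
Proof. by rewrite /clause_t; numeric. Qed.

Lemma numeric_clause_k : numeric (fun w g e => clause_k (T w) (F w g e)).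
Proof. by rewrite /clause_k; numeric. Qed.

Lemma definable_clause_active : definable (fun w g e => clause_active M w (T w) (F w g e)).
Proof.
apply: (@definable_cases #|template M| (fun k w g e => guard_holds w (T w)
  (clause_guard (nth_clause M k)) (clause_t (T w) (F w g e)) (clause_x (T w) (F w g e))
  (clause_y (T w) (F w g e)))) numeric_clause_k => [k|k w g e le_k].
  apply: definable_guard => //; first exact: numeric_clause_t.
    exact: numeric_clause_x.
  exact: numeric_clause_y.
by rewrite !nth_clause_default.
Qed.

Lemma definable_tab_sign i : definable (fun w g e => tab_sign M w (T w) (F w g e) i).
Proof.
apply: (definable_if definable_clause_active); last exact: definable_const.
apply: (@definable_cases #|template M|
  (fun k _ _ _ => lit_sign (clause_lit (nth_clause M k) i))) numeric_clause_k => [k|k w g e le_k].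
  exact: definable_const.
by rewrite !nth_clause_default.
Qed.

Lemma numeric_literal_number (l : literal M) : numeric (fun w g e => literal_number (T w) l
  (clause_t (T w) (F w g e)) (clause_x (T w) (F w g e)) (clause_y (T w) (F w g e))).
Proof.
have nt := numeric_clause_t; have nx := numeric_clause_x; have ny := numeric_clause_y.
have ns := numeric_pos_cell (lit_pos l) nx ny.
by rewrite /literal_number /fact_number; case: lit_next; numeric.
Qed.

Lemma numeric_tab_var i : numeric (fun w g e => tab_var M w (T w) (F w g e) i).
Proof.
apply: (numeric_if definable_clause_active); last exact: numeric_const.
apply: (@numeric_cases #|template M| (fun k w g e => literal_number (T w)
  (clause_lit (nth_clause M k) i) (clause_t (T w) (F w g e)) (clause_x (T w) (F w g e))
  (clause_y (T w) (F w g e)))) numeric_clause_k => [k|k w g e le_k].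
  exact: numeric_literal_number.
by rewrite !nth_clause_default.
Qed.

End Clause.

Notation nclause w := (tab_nclause M (T w)).
Notation nvar w := (nae_nvar (tab_nvar M (T w)) (nclause w)).
Notation sign w := (nae_sign (tab_sign M w (T w))).
Notation var w := (nae_var (tab_nvar M (T w)) (nclause w) (tab_var M w (T w))).

Lemma numeric_tab_nclause : numeric (fun w _ _ => nclause w).
Proof. by rewrite /tab_nclause; numeric. Qed.

Lemma numeric_tab_nvar : numeric (fun w _ _ => tab_nvar M (T w)).
Proof. by rewrite /tab_nvar; numeric. Qed.

Lemma numeric_nae_nvar : numeric (fun w _ _ => nvar w).
Proof.
have nc := numeric_tab_nclause; have nv := numeric_tab_nvar.
by rewrite /nae_nvar; numeric.
Qed.

Lemma definable_nae_sign k i : numeric k -> numeric i ->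
  definable (fun w g e => sign w (k w g e) (i w g e)).
Proof.
move=> nk ni; have nj : numeric (fun w g e => k w g e %/ 2) by numeric.
have s0 := definable_tab_sign nj 0; have s1 := definable_tab_sign nj 1.
by have s2 := definable_tab_sign nj 2; rewrite /nae_sign; numeric.
Qed.

Lemma numeric_nae_var k i : numeric k -> numeric i ->
  numeric (fun w g e => var w (k w g e) (i w g e)).
Proof.
move=> nk ni; have nj : numeric (fun w g e => k w g e %/ 2) by numeric.
have v0 := numeric_tab_var nj 0; have v1 := numeric_tab_var nj 1.
have v2 := numeric_tab_var nj 2; have nc := numeric_tab_nclause; have nv := numeric_tab_nvar.
by rewrite /nae_var; numeric.
Qed.

Notation back w := (nae_back (nvar w) (sign w) (var w)).

Lemma definable_nae_back u v : numeric u -> numeric v ->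
  definable (fun w g e => back w (u w g e) (v w g e)).
Proof.
move=> nu nv; have nn := numeric_nae_nvar.
have nk : numeric (fun w g e => clause_of (nvar w) (v w g e)).
  by rewrite /clause_of /first_occ; numeric.
have ni : numeric (fun w g e => place_of (nvar w) (v w g e)).
  by rewrite /place_of /first_occ; numeric.
have ds := definable_nae_sign nk ni; have nx := numeric_nae_var nk ni.
by rewrite /nae_back /first_occ; numeric.
Qed.

Lemma definable_gadget_back u v : numeric u -> numeric v ->
  definable (fun w g e => gadget_back (back w) (u w g e) (v w g e)).
Proof.
move=> nu nv; have d0 := definable_r7_back nu nv.
have nsub k z : numeric z -> numeric (fun w g e => z w g e - k) by move=> nz; numeric.
have d7 := definable_r7_back (nsub 7 _ nu) (nsub 7 _ nv).
have d14 := definable_nae_back (nsub 14 _ nu) (nsub 14 _ nv).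
by rewrite /gadget_back; numeric.
Qed.

Definition reduction (w : seq bool) : seq bool :=
  matrix_word (14 + nae_size (nvar w) (nclause w * 2)) (arc_of (gadget_back (back w))).

Lemma polytime_reduction : polytime_computable reduction.
Proof.
apply: polytime_matrix.
  have nn := numeric_nae_nvar; have nc := numeric_tab_nclause.
  by rewrite /nae_size /first_occ; numeric.
have uv := definable_gadget_back (numeric_var 1) (numeric_var 0).
have vu := definable_gadget_back (numeric_var 0) (numeric_var 1).
by rewrite /arc_of; numeric.
Qed.

Lemma reduction_tableau w : 0 < T w ->
  three_diomega_ordering (reduction w) <-> exists be, tableau (M := M) w (T w) be.
Proof.
move=> T_gt0; have var_lt j i : j < nclause w -> i < 3 ->
    tab_var M w (T w) j i < tab_nvar M (T w) by move=> lt_j _; apply: tab_var_lt.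
rewrite gadget_three_diomega nae_acyclic_coloring; last first.
  by move=> k i lt_k _; apply: (nae_var_lt var_lt).
by rewrite (nae_satisfiableE _ var_lt) satisfiable_tableau.
Qed.

End Reduction.

Lemma three_diomega_NP_hard : NP_hard three_diomega_ordering.
Proof.
move=> L [M [[p M_time] LM]]; pose T (w : seq bool) := p.[size w]%R + 1.
have nT : numeric (fun w _ _ => T w).
  by apply: numeric_add (numeric_const 1); apply: numeric_horner numeric_size.
exists (reduction M T); split=> [|w]; first exact: polytime_reduction.
rewrite LM reduction_tableau ?/T ?addn1 //.
split=> [|[be]]; first exact: accepts_tableau.
by apply: tableau_accepts => n c /M_time; rewrite ltnS.
Qed.

Theorem theorem3p9 : NP_complete three_diomega_ordering.
Proof. exact: conj three_diomega_in_NP three_diomega_NP_hard. Qed.
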